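(* On $\mathbb{C}_t\times\mathbb{C}^3$ with coordinates $t,y,\dot y,\ddot y$ consider the vector field $$\xi:=q(y,\dot y,\ddot y)\Big[\frac{\partial}{\partial t}+\dot y\frac{\partial}{\partial y}+\ddot y\frac{\partial}{\partial\dot y}+A(y,\dot y,\ddot y)\frac{\partial}{\partial\ddot y}\Big],$$ where $$q(y,\dot y,\ddot y)=y^3(y-1728)^3\dot y^2,\qquad A(y,\dot y,\ddot y)=-R(y)\dot y^3+\frac{3\ddot y^2}{2\dot y},\qquad R(y)=\frac{y^2-1968y+2654208}{2y^2(y-1728)^2}.$$ Then $\xi$ is defined over $\mathbb{Q}$ (it is a polynomial vector field with coefficients in $\mathbb{Q}[t,y,\dot y,\ddot y]$) and has constructible orbits in $\mathbb{C}_t\times\mathbb{C}^3$.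
   Context: The vector field encodes the equation $\chi(f)=0$ satisfied by the modular $j$-function, where $\chi(f)=S(f)+R(f)(f')^2$ and $S(f)=(f''/f')'-\tfrac12(f''/f')^2$ is the Schwarzian derivative; i.e. $f'''=A(f,f',f'')$. For a polynomial vector field $\xi$ on $\mathbb{C}^n$, $\operatorname{Sing}\xi$ is the common zero set of its coefficients. For $p\in\mathbb{C}^n$ the orbit $\mathcal{O}_p$ is the leaf through $p$ of the singular complex holomorphic foliation defined by $\xi$: if $p\in\operatorname{Sing}\xi$ then $\mathcal{O}_p=\{p\}$, and otherwise $\mathcal{O}_p$ is the leaf through $p$ of the foliation of $\mathbb{C}^n\setminus\operatorname{Sing}\xi$ by complex integral curves of $\xi$. $\overline{\mathcal{O}}_p$ denotes the Zariski closure of $\mathcal{O}_p$. For $\xi$ and a $\xi$-invariant variety $V$ (a union of orbits) defined over an algebraically closed field $\mathbb{K}\subset\mathbb{C}$ (here one may take $\mathbb{K}=\overline{\mathbb{Q}}$), $\xi$ has constructible orbits in $V$ if the relation $E=\{(p,q)\in V\times V: q\in\overline{\mathcal{O}}_p\}$ is constructible over $\mathbb{K}$. *)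

(* Defs.v *)
From Stdlib Require Import Relation_Operators.
From mathcomp Require Import all_boot all_order all_algebra.
From mathcomp Require Import -(notations) mpoly.
From mathcomp Require Import complex.
From mathcomp Require Import boolp classical_sets reals topology normedtype derive.
Set Implicit Arguments.
Unset Strict Implicit.
Unset Printing Implicit Defensive.
Import Order.TTheory GRing.Theory Num.Theory.
Import numFieldNormedType.Exports.
Local Open Scope classical_set_scope.
Local Open Scope ring_scope.

(* The notations of [mpoly] clash with those of MathComp-Analysis. *)
Notation "{ 'mpoly' T [ n ] }" := (mpoly n T)
  (at level 0, T, n at level 2, format "{ 'mpoly'  T [ n ] }") : type_scope.

Section Foliation.
Variables (C : numClosedFieldType) (n : nat).
Implicit Types (P : {mpoly C[n]}) (xi : 'I_n -> {mpoly C[n]}) (p q : 'rV[C]_n).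

Definition peval P p : C := meval (p 0) P.

Definition Sing xi : set 'rV[C]_n := [set p | forall i, peval (xi i) p = 0].

(* The derivative along 1 over the base field C is the complex derivative. *)
Definition integral_curve xi (D : set C) (phi : C -> 'rV[C]_n) : Prop :=
  forall z, D z ->
    ~ Sing xi (phi z) /\
    forall i, is_derive z 1 (fun w : C => phi w 0 i) (peval (xi i) (phi z)).

Definition on_common_curve xi p q : Prop :=
  exists (D : set C) (phi : C -> 'rV[C]_n),
    [/\ open D, connected D, integral_curve xi D phi
      & (phi @` D) p /\ (phi @` D) q].

(* The leaves of the regular foliation of C^n \ Sing xi are the classes of the
   equivalence relation generated by lying on a common local integral curve;
   [on_common_curve] is already symmetric. *)
Definition leaf xi p : set 'rV[C]_n :=
  [set q | clos_refl_trans _ (on_common_curve xi) p q].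

Definition orbit xi p : set 'rV[C]_n :=
  [set q | (Sing xi p /\ q = p) \/ (~ Sing xi p /\ leaf xi p q)].

Definition zariski_closure (S : set 'rV[C]_n) : set 'rV[C]_n :=
  [set q | forall P, (forall p, S p -> peval P p = 0) -> peval P q = 0].

Definition defined_over (K : set C) P : Prop := forall m, K (mcoeff m P).

(* Finite Boolean combinations of zero sets of polynomials over K. *)
Inductive constructible (K : set C) : set 'rV[C]_n -> Prop :=
| constructible_zeros P of defined_over K P :
    constructible K [set p | peval P p = 0]
| constructibleC A of constructible K A : constructible K (~` A)
| constructibleI A B of constructible K A & constructible K B :
    constructible K (A `&` B).

End Foliation.

(* C^n x C^n is identified with C^(n + n) by concatenation of rows. *)
Definition orbit_relation (C : numClosedFieldType) (n : nat)
    (xi : 'I_n -> {mpoly C[n]}) (V : set 'rV[C]_n) : set 'rV[C]_(n + n) :=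
  [set pq | [/\ V (lsubmx pq), V (rsubmx pq)
              & zariski_closure (orbit xi (lsubmx pq)) (rsubmx pq)]].

(* Meant for an algebraically closed subfield K of C and a xi-invariant variety V,
   with xi and V defined over K. *)
Definition has_constructible_orbits (C : numClosedFieldType) (K : set C)
    (n : nat) (xi : 'I_n -> {mpoly C[n]}) (V : set 'rV[C]_n) : Prop :=
  constructible K (orbit_relation xi V).

Definition rationals (C : numClosedFieldType) : set C := range (ratr : rat -> C).

Definition algebraic_numbers (C : numClosedFieldType) : set C :=
  [set z | algebraicOver (ratr : rat -> C) z].

Arguments rationals C : clear implicits.
Arguments algebraic_numbers C : clear implicits.

(* 2654208 = 1536 * 1728; the plain literal would be a unary numeral. *)
Definition j_R (F : fieldType) (y : F) : F :=
  (y ^+ 2 - 1968 * y + 1536 * 1728) / (2 * y ^+ 2 * (y - 1728) ^+ 2).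

Definition j_A (F : fieldType) (y y1 y2 : F) : F :=
  - j_R y * y1 ^+ 3 + 3 * y2 ^+ 2 / (2 * y1).

Definition j_q (F : fieldType) (y y1 : F) : F :=
  y ^+ 3 * (y - 1728) ^+ 3 * y1 ^+ 2.

(* The coefficients of d/dt, d/dy, d/dy' and d/dy'', in this order; since R and
   A are not polynomials, they are elements of C(t, y, y', y''). *)
Definition j_field (C : numClosedFieldType) (i : 'I_4) :
    {fraction {mpoly C[4]}} :=
  let coordinate k := FracField.tofrac (mpolyX C (mnm1 (inord k : 'I_4))) in
  let y := coordinate 1 in
  let y1 := coordinate 2 in
  let y2 := coordinate 3 in
  j_q y y1 * [:: 1; y1; y2; j_A y y1 y2]`_i.

(* Main.v *)
Require Import Defs.
From mathcomp Require Import all_boot all_order all_algebra.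
From mathcomp Require Import -(notations) mpoly.
From mathcomp Require Import complex.
From mathcomp Require Import boolp classical_sets reals topology normedtype derive.
From mathcomp Require Import ring lra zify.
Set Implicit Arguments.
Unset Strict Implicit.
Unset Printing Implicit Defensive.
Import Order.TTheory GRing.Theory Num.Theory.
Import numFieldNormedType.Exports.
Import Pdiv.Idomain.
Local Open Scope classical_set_scope.
Local Open Scope ring_scope.

(** At a point of the zero set of q the orbit is a single point, so the theorem
    comes down to one claim: every other orbit is Zariski dense in C^4
    ([nonsingular_orbit_dense]). Then x lies in the closure of the orbit of p if
    and only if p is nonsingular or x = p, which is a Boolean combination of
    zero sets of polynomials with rational coefficients.

    Density. Write a = 1728 and let P vanish on the orbit of a nonsingular p.
    The orbit contains a holomorphic solution curve through p ([local_flow]); it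
    suffices that P vanishes on this curve. On the curve use the coordinates
      y,   U = y(y-a)y''/(2y'^2) - y/2,   s = y(y-a)/y',   t
    and the derivation D = (y(y-a)/y') d/dt, for which
      Dy = y(y-a),              DU = -U^2 + (y-a)U + (41a/144)y - 2a^2/9,
      Ds = (y-a-2U)s,           Dt = s.
    These formulas define derivations of C[y], C[y][U], C[y][U][s] and
    C[y][U][s][t], each one extending the preceding one. The polynomials all of
    whose iterated derivatives vanish at a given point form a prime ideal that
    is stable under D ([flat_prime]), and it contains the polynomial obtained
    from P. The claim is that this ideal is zero ([flat_t_trivial]): t, y, y',
    y'' are algebraically independent along every solution.

    The variables are added one at a time. If the ideal is zero below and not
    zero after one more variable has been added, an element of least degree
    divides its own derivative ([flat_minimal]), up to factors from below. So
    the polynomials P that divide DP have to be determined.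

    - For U ([darboux_U]) this says that no solution of the Riccati equation is
      algebraic over C(y). If DP = LP with P of degree n in U and with leading
      coefficient of degree d in y, then L = -nU + l(y); comparing degrees in y
      gives l(y) = (n+d)y + mu, whereas on the lines y = 0 and y = a, where DU
      is a product of two linear factors, L can take only n + 1 explicit values.
      This yields 12(n+d) = n + 6j + 4i with i, j <= n, hence n = 0. In
      terms of the linear equation behind the Riccati equation, whose exponent
      differences at 0, a and infinity are 1/3, 1/2 and 0, this is the
      inequality 1/3 + 1/2 + 0 < 1.
    - For s ([darboux_s]): no h in C(y,U) satisfies Dh = -M(y-a-2U)h with
      M > 0, since numerator and denominator of h would divide their
      derivatives and thus be free of U.
    - For t ([darboux_t]): no h in C(y,U,s) satisfies Dh = -Ms with M > 0. By the
      previous case the denominator of h is a monomial in s, and the coefficient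
      of s in h would solve an equation over C(y,U) that is impossible by degree
      in U. *)

(** * Derivations of polynomial rings *)
Definition derivation (R : comNzRingType) (d : R -> R) : Prop :=
  (forall x y, d (x + y) = d x + d y) /\
  (forall x y, d (x * y) = d x * y + x * d y).

Section Derivation.
Variables (R : comNzRingType) (d : R -> R) (derd : derivation d).

Lemma derD x y : d (x + y) = d x + d y. Proof. exact: derd.1. Qed.
Lemma derM x y : d (x * y) = d x * y + x * d y. Proof. exact: derd.2. Qed.
Lemma der0 : d 0 = 0.
Proof. by apply: (addrI (d 0)); rewrite -derD !addr0. Qed.
Lemma der_sum (I : Type) (r : seq I) (F : I -> R) :
  d (\sum_(i <- r) F i) = \sum_(i <- r) d (F i).
Proof. exact: (big_morph d derD der0). Qed.

Lemma iter_derD k x y : iter k d (x + y) = iter k d x + iter k d y.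
Proof. by elim: k => //= k ->; rewrite derD. Qed.

(** The derivation of R[X] that extends [d] and maps 'X to [F]. *)
Definition poly_der (F P : {poly R}) : {poly R} :=
  \poly_(i < size P) d P`_i + F * P^`().

Lemma coef_poly_der0 (P : {poly R}) i : (\poly_(j < size P) d P`_j)`_i = d P`_i.
Proof.
by rewrite coef_poly; case: ltnP => // h; rewrite [P`_i]nth_default // der0.
Qed.

Lemma poly_derP F : derivation (poly_der F).
Proof.
split=> P Q; rewrite /poly_der.
  rewrite derivD mulrDr addrACA; congr (_ + _).
  by apply/polyP=> i; rewrite coefD !coef_poly_der0 coefD derD.
have -> : \poly_(i < size (P * Q)) d (P * Q)`_i =
    (\poly_(i < size P) d P`_i) * Q + P * (\poly_(i < size Q) d Q`_i).
  apply/polyP=> i; rewrite coefD !coefM coef_poly_der0 coefM der_sum -big_split.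
  by apply: eq_bigr => j _; rewrite !coef_poly_der0 derM.
by rewrite derivM; ring.
Qed.

Lemma poly_derC F c : poly_der F c%:P = (d c)%:P.
Proof.
rewrite /poly_der derivC mulr0 addr0; apply/polyP=> i.
rewrite coef_poly_der0 !coefC; case: (i == 0)%N => //; exact: der0.
Qed.

Lemma der1 : d 1 = 0.
Proof. by apply: (addrI (d 1)); rewrite addr0 -[in RHS](mulr1 1) derM mulr1 mul1r. Qed.

Lemma poly_derX F : poly_der F 'X = F.
Proof.
rewrite /poly_der derivX mulr1 -[RHS]add0r; congr (_ + _).
apply/polyP=> i; rewrite coef_poly_der0 coefX coef0.
case: (i == 1)%N; [exact: der1 | exact: der0].
Qed.

Lemma coef_poly_der F P i : (poly_der F P)`_i = d P`_i + (F * P^`())`_i.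
Proof. by rewrite coefD coef_poly_der0. Qed.

End Derivation.

(** * First-order linear equations over a fraction field *)
Section Linear.
Variables (R : idomainType) (d : {poly R} -> {poly R}) (derd : derivation d).
Implicit Types (f g al be : {poly R}).

(** The quotient h = f / g satisfies h' = al h + be; multiplying by g^2 states this
    without a field of fractions. *)
Definition solves al be f g := g * d f - f * d g = g * (al * f + be * g).

(** Division by the gcd leaves the quotient f / g unchanged. In lowest terms the
    equation shows that g1 divides f1 g1', hence g1'. Divisibility is
    pseudo-divisibility over R, that is, divisibility over the fractions of R. *)
Lemma solves_reduced al be f g : g != 0 -> solves al be f g ->
  exists f1 g1, [/\ g1 != 0, f * g1 = f1 * g, coprimep f1 g1, solves al be f1 g1
                  & g1 %| d g1].
Proof.
move=> g0 sol; pose h := gcdp f g.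
have h0 : h != 0 by rewrite gcdp_eq0 (negPf g0) andbF.
have := dvdp_gcdl f g; rewrite -/h dvdp_eq => /eqP Ef.
have := dvdp_gcdr f g; rewrite -/h dvdp_eq => /eqP Eg.
set c := _ ^+ _ in Ef; set e := _ ^+ _ in Eg.
have c0 : c != 0 by rewrite expf_neq0 // lead_coef_eq0.
have e0 : e != 0 by rewrite expf_neq0 // lead_coef_eq0.
pose f1 := e *: (f %/ h); pose g1 := c *: (g %/ h).
have gh0 : g %/ h != 0.
  by apply/eqP=> E; move: Eg; rewrite E mul0r => /eqP; rewrite scale_poly_eq0 (negPf e0) (negPf g0).
have g10 : g1 != 0 by rewrite scale_poly_eq0 negb_or c0.
have E1 : f * g1 = f1 * g.
  rewrite /f1 /g1 -scalerAr scalerAl Ef -scalerAl scalerAr Eg; ring.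
have cop : coprimep f1 g1.
  by rewrite coprimepZl // coprimepZr // coprimep_div_gcd // g0 orbT.
have sol1 : solves al be f1 g1.
  have E2 : d f * g1 + f * d g1 = d f1 * g + f1 * d g.
    by rewrite -!derM // E1.
  apply: (mulIf (mulf_neq0 g0 g0)).
  have -> : (g1 * d f1 - f1 * d g1) * (g * g) = (g * d f - f * d g) * (g1 * g1).
    have -> : (g1 * d f1 - f1 * d g1) * (g * g) =
      g1 * g * (d f1 * g + f1 * d g) - g * ((f1 * g) * d g1) - g1 * d g * (f1 * g)
      by ring.
    by rewrite -E2 -E1; ring.
  rewrite sol.
  have -> : g * (al * f + be * g) * (g1 * g1) = g * g1 * (al * (f * g1) + be * g * g1)
    by ring.
  by rewrite E1; ring.
exists f1, g1; split=> //.
rewrite -(@Gauss_dvdpr _ _ f1); last by rewrite coprimep_sym.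
have -> : f1 * d g1 = g1 * (d f1 - al * f1 - be * g1).
  move: sol1; rewrite /solves => /eqP; rewrite subr_eq => /eqP E.
  by rewrite !mulrBr E; ring.
exact: dvdp_mulIl.
Qed.

Lemma solves0_dvd al f g : solves al 0 f g -> coprimep f g -> f %| d f.
Proof.
move=> sol cop; rewrite -(@Gauss_dvdpr _ _ g) //.
move: sol; rewrite /solves mul0r addr0 => /eqP; rewrite subr_eq => /eqP ->.
have -> : g * (al * f) + f * d g = f * (g * al + d g) by ring.
exact: dvdp_mulIl.
Qed.

End Linear.

(** * Elements vanishing to infinite order at a point *)
Lemma derMn (R : comNzRingType) (d : R -> R) (derd : derivation d) x n :
  d (x *+ n) = d x *+ n.
Proof.
by elim: n => [|n IH]; rewrite ?mulr0n ?der0 // !mulrS derD // IH.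
Qed.

Lemma iter_derM (R : comNzRingType) (d : R -> R) (derd : derivation d) n x y :
  iter n d (x * y) =
  \sum_(i < n.+1) (iter i d x * iter (n - i) d y) *+ 'C(n, i).
Proof.
elim: n => [|n IH]; first by rewrite big_ord_recl big_ord0 addr0.
rewrite iterS IH der_sum //.
under eq_bigr => i _ do rewrite derMn // derM // mulrnDl -!iterS.
rewrite big_split /= [in RHS]big_ord_recl /= bin0.
under [in RHS]eq_bigr => i _ do rewrite /bump /= add1n binS subSS mulrnDr.
rewrite big_split /= addrC [in RHS]addrA; congr (_ + _).
rewrite big_ord_recl big_ord_recr /= (@bin_small n n.+1) // mulr0n addr0 subn0 bin0.
congr (_ + _).
by apply: eq_bigr => i _; rewrite /bump /= add1n; congr (_ * _ *+ _); rewrite -iterS -subSn // subSS.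
Qed.

Section FlatIdeal.
Variables (R : comNzRingType) (d : R -> R) (derd : derivation d).
Variables (C : numFieldType) (ev : {rmorphism R -> C}).

(** The elements whose iterated derivatives all vanish at the point [ev]. They
    form a differential ideal, which replaces the ideal of functions vanishing
    on the solution through the point. *)
Definition flat (x : R) : Prop := forall k, ev (iter k d x) = 0.

Lemma flatD x y : flat x -> flat y -> flat (x + y).
Proof. by move=> hx hy k; rewrite iter_derD // rmorphD /= hx hy addr0. Qed.

Lemma flat_der x : flat x -> flat (d x).
Proof. by move=> hx k; rewrite -iterSr. Qed.

Lemma flatMl x y : flat y -> flat (x * y).
Proof.
move=> hy k; rewrite iter_derM // rmorph_sum big1 // => i _.
by rewrite rmorphMn rmorphM /= hy mulr0 mul0rn.
Qed.

Lemma flat_order x : ~ flat x ->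
  exists2 k, ev (iter k d x) != 0 & forall i, (i < k)%N -> ev (iter i d x) = 0.
Proof.
move=> nx; have [k hk] : exists k, ev (iter k d x) != 0.
  apply: contrapT => h; apply: nx => k; apply/eqP/negPn/negP => e.
  by apply: h; exists k.
have ex : exists k, ev (iter k d x) != 0 by exists k.
case: (ex_minnP ex) => m hm minm; exists m => // i im; apply/eqP; apply: contraLR im.
by rewrite -leqNgt; apply: minm.
Qed.

(** If x and y vanish to the exact orders k and l, the derivative of order k + l of
    x y has the value 'C(k + l, k) d^k x d^l y, which is not zero in
    characteristic 0. *)
Lemma flat_prime x y : flat (x * y) -> flat x \/ flat y.
Proof.
move=> hxy; apply: contrapT => /not_orP[/flat_order[k hk lk] /flat_order[l hl ll]].
have := hxy (k + l)%N; rewrite iter_derM // rmorph_sum /=.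
have kl : (k < (k + l).+1)%N by rewrite ltnS leq_addr.
rewrite (bigD1 (Ordinal kl)) //= big1 => [|i ne]; last first.
  rewrite rmorphMn rmorphM /=.
  have [ik|] := ltnP i k; first by rewrite lk // mul0r mul0rn.
  rewrite leq_eqVlt => /orP[/eqP E|ki].
    by case/eqP: ne; apply/val_inj.
  by rewrite ll ?mulr0 ?mul0rn //; have := ltn_ord i; lia.
rewrite addr0 rmorphMn rmorphM addKn /= => /eqP.
by rewrite mulrn_eq0 mulf_eq0 (negPf hk) (negPf hl) orbF eqn0Ngt bin_gt0 leq_addr.
Qed.

End FlatIdeal.

(** * Adding one variable *)
Section Elimination.
Variables (R : idomainType) (d : R -> R) (derd : derivation d).
Variables (C : numFieldType) (ev : {rmorphism R -> C}) (x : C) (F : {poly R}).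

Definition eval_ext : {rmorphism {poly R} -> C} := (horner_eval x \o map_poly ev)%FUN.

Lemma eval_extC c : eval_ext c%:P = ev c.
Proof. by rewrite /= map_polyC /horner_eval hornerC. Qed.

Lemma eval_extX : eval_ext 'X = x.
Proof. by rewrite /= map_polyX /horner_eval hornerX. Qed.

Lemma flatC c : flat (poly_der d F) eval_ext c%:P -> flat d ev c.
Proof.
move=> h k; have := h k; suff -> : iter k (poly_der d F) c%:P = (iter k d c)%:P.
  by rewrite eval_extC.
by elim: k => //= k ->; rewrite poly_derC.
Qed.

(** A nonzero flat polynomial P of least degree pseudo-divides every flat
    polynomial, because the remainder is flat and of lower degree. In particular
    it pseudo-divides its derivative; it is not constant since no nonzero constant
    is flat. *)
Lemma flat_minimal (Q : {poly R}) :
  (forall c, flat d ev c -> c = 0) ->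
  flat (poly_der d F) eval_ext Q -> Q != 0 ->
  exists P, [/\ flat (poly_der d F) eval_ext P, (1 < size P)%N
              & P %| poly_der d F P].
Proof.
move=> trivR fQ Q0.
have derF := poly_derP derd F.
have [n] := ubnP (size Q); elim: n Q fQ Q0 => // n IH P fP P0 sP.
have [red|irr] := pselect (exists2 Q, flat (poly_der d F) eval_ext Q & Q %% P != 0).
  case: red => Q fQ QP0; apply: (IH (Q %% P)) => //; last first.
    by rewrite -ltnS (leq_trans _ sP) // ltnS ltn_modp.
  have -> : Q %% P = (lead_coef P ^+ scalp Q P)%:P * Q + (- (Q %/ P)) * P.
    by rewrite mul_polyC divp_eq mulNr addrAC subrr add0r.
  by apply: flatD => //; apply: flatMl.
exists P; split=> //.
  rewrite ltnNge; apply/negP => /size1_polyC E; move: P`_0 E => c E.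
  rewrite E in fP P0; have := trivR c (flatC fP) => c0.
  by rewrite c0 eqxx in P0.
apply/modp_eq0P/eqP; apply: contra_notT irr => nz.
by exists (poly_der d F P) => //; apply: flat_der.
Qed.

End Elimination.

(** * Algebraic solutions of the Riccati equation *)
Section QuadraticResidue.
Variable (C : numFieldType).

(** The equation determines p' / p, so that p is a multiple of
    (X - s)^i (X - r)^(n - i), and then k = i r + (n - i) s. *)
Lemma quadratic_residue (p : {poly C}) (n : nat) (s r k : C) :
  p != 0 -> ('X - s%:P) * ('X - r%:P) * p^`() = (n%:R *: 'X - k%:P) * p ->
  exists2 i, (i <= n)%N & k = n%:R * s - i%:R * (s - r).
Proof.
move=> p0 E.
have sp : (size p).-1 = n.
  have [m Em] : exists m, size p = m.+1 by exists (size p).-1; rewrite prednK ?size_poly_gt0.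
  have lm : p`_m != 0 by move: p0; rewrite -lead_coef_eq0 lead_coefE Em.
  have pS : p`_m.+1 = 0 by rewrite nth_default ?Em.
  have pSS : p`_m.+2 = 0 by rewrite nth_default ?Em.
  have := congr1 (fun q : {poly C} => q`_m.+1) E.
  have -> : ('X - s%:P) * ('X - r%:P) * p^`() =
    'X * ('X * p^`()) - (s + r) *: ('X * p^`()) + (s * r) *: p^`().
    by rewrite -!mul_polyC polyCD polyCM; ring.
  rewrite mulrBl -scalerAl mul_polyC !(coefD, coefN, coefZ, coefXM, coef_deriv) /=.
  rewrite pS pSS !mul0rn !mulr0 oppr0 !addr0.
  case: m Em lm {pS pSS} => [|m] Em lm /=.
    by move/eqP; rewrite eq_sym mulf_eq0 (negPf lm) orbF pnatr_eq0 => /eqP ->; rewrite Em.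
  rewrite -[p`_m.+1 *+ _]mulr_natl => /eqP; rewrite -subr_eq0 -mulrBl mulf_eq0 (negPf lm) orbF.
  by rewrite subr_eq0 eqr_nat Em => /eqP.
have [i [q qs Ep]] := multiplicity_XsubC p s; rewrite p0 /= in qs.
have qs0 : q.[s] != 0 by [].
have q0 : q != 0 by apply: contraNneq qs0 => ->; rewrite horner0.
exists i.
  rewrite -sp Ep size_Mmonic ?monic_exp ?monicXsubC // size_exp_XsubC.
  by move: q0; rewrite -size_poly_gt0; case: (size q) => // m _; rewrite addnS leq_addl.
have : ((s - r) * i%:R) * q.[s] = (n%:R * s - k) * q.[s].
  case: i Ep => [|i] Ep.
    rewrite mulr0 mul0r; have := congr1 (horner^~ s) E.
    by rewrite Ep expr0 mulr1 !hornerE subrr !mul0r.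
  have E1 : ('X - r%:P) * (q^`() * ('X - s%:P) + q *+ i.+1) = (n%:R *: 'X - k%:P) * q.
    apply: (mulIf (expf_neq0 i.+1 (negbT (polyXsubC_eq0 s)))).
    rewrite -[RHS]mulrA -Ep -E Ep derivM deriv_exp derivXsubC mul1r /=.
    rewrite -[in RHS]mulr_natl -[q *+ _]mulr_natl exprS.
    move: (_ ^+ i) => t; move: q^`() (i.+1%:R) => q' j; ring.
  have := congr1 (horner^~ s) E1.
  by rewrite !hornerE hornerMn subrr mulr0 add0r => <-; rewrite -mulr_natr; ring.
move/eqP; rewrite -subr_eq0 -mulrBl mulf_eq0 (negPf qs0) orbF subr_eq0 => /eqP h.
by rewrite [i%:R * _]mulrC h; ring.
Qed.
End QuadraticResidue.

Section Riccati.
Variables (C : numClosedFieldType) (a : C).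
Implicit Types (P : {poly {poly C}}).

(** With v = y'' / (2 y'^2), a solution satisfies dv/dy = - v^2 - R(y)/2. The
    variable U = y (y - a) v - y/2 and the vector field y (y - a) d/dy make the
    equation polynomial; the shift by y/2 makes the constant term [vel_U0] linear
    in y. *)
Definition vel_y : {poly C} := 'X * ('X - a%:P).
Definition der_y : {poly C} -> {poly C} := poly_der (fun _ => 0) vel_y.

Definition vel_U0 : {poly C} := (41%:R * a / 144%:R) *: 'X - (2%:R * a ^+ 2 / 9%:R)%:P.
Definition vel_U : {poly {poly C}} :=
  - ('X * 'X) + ('X - a%:P)%:P * 'X + vel_U0%:P.
Definition der_U : {poly {poly C}} -> {poly {poly C}} := poly_der der_y vel_U.

Lemma derivation_zero : derivation (fun _ : C => 0).
Proof. by split=> x y; rewrite ?mulr0 ?mul0r addr0. Qed.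

Lemma derivation_y : derivation der_y.
Proof. exact/poly_derP/derivation_zero. Qed.

Lemma derivation_U : derivation der_U.
Proof. exact/poly_derP/derivation_y. Qed.

Lemma der_yE c : der_y c = vel_y * c^`().
Proof.
by apply/polyP=> i; rewrite (coef_poly_der derivation_zero) add0r.
Qed.

Lemma coefX_deriv (R : nzSemiRingType) (P : {poly R}) i : ('X * P^`())`_i = P`_i *+ i.
Proof. by rewrite coefXM; case: i => //= i; rewrite coef_deriv. Qed.

Lemma vel_UM P : vel_U * P^`() = - ('X * ('X * P^`())) + ('X - a%:P)%:P * ('X * P^`())
  + vel_U0%:P * P^`().
Proof. by rewrite /vel_U; ring. Qed.

Lemma coef0_der_U P : (der_U P)`_0 = vel_y * (P`_0)^`() + vel_U0 * P`_1.
Proof.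
rewrite (coef_poly_der derivation_y) der_yE vel_UM !coefD coefN !coefCM coefXM.
by rewrite coefX_deriv coef_deriv mulr0n mulr0 oppr0 !add0r mulr1n.
Qed.

Lemma coefS_der_U P k : (der_U P)`_k.+1 = vel_y * (P`_k.+1)^`() +
  (- (P`_k *+ k) + ('X - a%:P) * (P`_k.+1 *+ k.+1) + vel_U0 * (P`_k.+2 *+ k.+2)).
Proof.
rewrite (coef_poly_der derivation_y) der_yE vel_UM !coefD coefN !coefCM coefXM.
by rewrite !coefX_deriv coef_deriv.
Qed.

(** Restriction to the line y = z. *)
Definition fiber (z : C) : {rmorphism {poly {poly C}} -> {poly C}} :=
  map_poly (horner_eval z).

(** The lines y = 0 and y = a are invariant under the vector field. *)
Lemma fiber_der_U z P : vel_y.[z] = 0 -> fiber z (der_U P) = fiber z vel_U * (fiber z P)^`().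
Proof.
move=> bz; rewrite /= deriv_map -rmorphM; apply/polyP=> i; rewrite !coef_map /=.
by rewrite (coef_poly_der derivation_y) der_yE /horner_eval hornerD hornerM bz mul0r add0r.
Qed.

Lemma fiber_eq0 z P : fiber z P = 0 -> exists P1 : {poly {poly C}}, P = ('X - z%:P)%:P * P1.
Proof.
move=> h; exists (map_poly (fun c => c %/ ('X - z%:P)) P).
apply/polyP=> i; rewrite coefCM coef_map_id0 ?div0p // mulrC.
apply/eqP; rewrite eqp_div_XsubC dvdp_XsubCl; apply/rootP.
by have := congr1 (fun p : {poly C} => p`_i) h; rewrite /= coef_map coef0.
Qed.

(** If P = (y - z) P1, then P' = (y - z)' P1 + (y - z) P1', and y - z, being free
    of U, is invertible for pseudo-divisibility; so P1 divides P1'. *)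
Lemma darboux_primitive_part P : P != 0 -> P %| der_U P ->
  exists P1, [/\ size P1 = size P, P1 %| der_U P1 & forall z, fiber z P1 != 0].
Proof.
have [n] := ubnP (size (lead_coef P)); elim: n P => // n IH P sP P0 dP.
have [[z /fiber_eq0[P1 E]]|prim] := pselect (exists z, fiber z P = 0); last first.
  by exists P; split=> // z; apply/eqP => h; apply: prim; exists z.
have z0 : 'X - z%:P != 0 by rewrite polyXsubC_eq0.
have P10 : P1 != 0 by apply: contraNneq P0 => h; rewrite E h mulr0.
have sP1 : size P1 = size P by rewrite E mul_polyC size_scale.
have [] // := IH P1.
- have : size (lead_coef P) = (size (lead_coef P1)).+1.
    rewrite E mul_polyC lead_coefZ size_monicM ?monicXsubC ?lead_coef_eq0 //.
    by rewrite size_XsubC.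
  by move=> h; rewrite h ltnS in sP.
- have : P1 %| der_U P by apply: dvdp_trans dP; rewrite E dvdp_mulIr.
  rewrite E (derM derivation_U) dvdp_addr; last exact: dvdp_mulIr.
  by rewrite mul_polyC dvdpZr.
- by move=> Q [sQ dQ pQ]; exists Q; rewrite sQ sP1.
Qed.

(** In c P' = L P, a root z of c is a root of L, since P is not zero on the line
    y = z; hence y - z can be cancelled until c is constant. *)
Lemma cofactor_poly P : P %| der_U P -> (forall z, fiber z P != 0) ->
  exists L, der_U P = L * P.
Proof.
move=> /dvdpP [[c L] /= c0 E] prim.
have [n] := ubnP (size c); elim: n c L c0 E => // n IH c L c0 E sc.
have [/size_poly1P[k k0 Ek]|c1] := boolP (size c == 1)%N.
  exists (k^-1%:P%:P * L); rewrite -mulrA -E Ek -mul_polyC mulrA -!polyCM.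
  by rewrite mulVf // mul1r.
have /closed_rootP[z /rootP cz] := c1.
have /eqP : fiber z L * fiber z P = 0.
  rewrite -rmorphM -E; apply/polyP=> i; rewrite coef_map coefZ coef0.
  by rewrite /= /horner_eval hornerM cz mul0r.
rewrite mulf_eq0 (negPf (prim z)) orbF => /eqP /fiber_eq0[L1 EL].
have Ec : c = c %/ ('X - z%:P) * ('X - z%:P).
  by apply/eqP; rewrite eqp_div_XsubC dvdp_XsubCl; apply/rootP.
set c' := _ %/ _ in Ec.
have c'0 : c' != 0 by apply: contraNneq c0 => h; rewrite Ec h mul0r.
apply: (IH c' L1) => //.
  have z0 : ('X - z%:P)%:P != 0 :> {poly {poly C}}.
    by rewrite polyC_eq0 polyXsubC_eq0.
  apply: (mulfI z0); rewrite mulrA -EL -E Ec -!mul_polyC polyCM; ring.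
by move: sc; rewrite Ec size_mul ?polyXsubC_eq0 // size_XsubC addn2.
Qed.

Section Cofactor.
Variables (P L : {poly {poly C}}).
Hypotheses (P0 : P != 0) (darboux : der_U P = L * P).
Let n := (size P).-1.
Let l := L`_0.

(** The vector field has degree 2 in U, with leading coefficient -1, so the
    cofactor has degree 1 and leading coefficient -n. *)
Lemma cofactor_shape : L = - 'X *+ n + l%:P.
Proof.
have sP : size P = n.+1 by rewrite prednK ?size_poly_gt0.
have lP : P`_n != 0 by move: P0; rewrite -lead_coef_eq0 lead_coefE sP.
have sL : (size L <= 2)%N.
  have [->|L0] := eqVneq L 0; first by rewrite size_poly0.
  have : (size (L * P)%R <= n.+2)%N.
    rewrite -darboux; apply/leq_sizeP => -[|k] //; rewrite ltnS => nk.
    have nd i : (n < i)%N -> P`_i = 0 by move=> ni; rewrite nth_default ?sP.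
    rewrite coefS_der_U !nd ?ltnS ?leqW // 1?ltnW //.
    by rewrite deriv0 !mul0rn !mulr0 oppr0 !addr0.
  by rewrite size_mul // sP addnS /= -[n.+2]/(2 + n)%N leq_add2r.
have E1 : L`_1 = - 1 *+ n.
  have := congr1 (fun q : {poly {poly C}} => q`_n.+1) darboux.
  have -> : L * P = L`_1 *: ('X * P) + l *: P.
    rewrite -!mul_polyC [in LHS](_ : L = (L`_1)%:P * 'X + l%:P); first by ring.
    apply/polyP=> -[|[|i]]; rewrite coefD coefMX !coefC /= ?add0r ?addr0 //.
    by rewrite nth_default // (leq_trans sL).
  rewrite coefS_der_U coefD !coefZ coefXM /= [P`_n.+1]nth_default ?sP //.
  rewrite [P`_n.+2]nth_default ?sP // deriv0 !mul0rn !mulr0 !addr0 add0r.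
  by move/esym => h; apply: (mulIf lP); rewrite h mulrnAl mulN1r mulNrn.
apply/polyP=> -[|[|i]]; rewrite coefD coefC coefMn coefN coefX /= ?mul0rn ?oppr0 ?mul0rn ?add0r ?addr0 //.
by rewrite nth_default // (leq_trans sL).
Qed.

(** On an invariant line the Darboux equation becomes the equation of
    [quadratic_residue], which leaves n + 1 possible values for l. *)
Lemma fiber_cofactor z s r : vel_y.[z] = 0 -> fiber z P != 0 ->
  fiber z vel_U = - (('X - s%:P) * ('X - r%:P)) ->
  exists2 i, (i <= n)%N & l.[z] = n%:R * s - i%:R * (s - r).
Proof.
move=> bz pz vz; apply: (quadratic_residue pz).
have := congr1 (fiber z) darboux.
rewrite fiber_der_U // vz [in RHS]rmorphM /= {1}cofactor_shape => /eqP.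
rewrite mulNr eqr_oppLR => /eqP ->; rewrite -mulNr; congr (_ * _).
rewrite rmorphD rmorphMn rmorphN /= map_polyX map_polyC /= /horner_eval.
by rewrite scaler_nat opprD mulNrn opprK.
Qed.

(* Comparing the coefficients of U^(k+1) in P' = L P expresses the k-th coefficient
   of P through the following two: T k.+1 = (n - k) P`_k. *)
Let T k := l * P`_k - vel_y * (P`_k)^`() - ('X - a%:P) * (P`_k *+ k)
  - vel_U0 * (P`_k.+1 *+ k.+1).

Lemma coef_recurrence0 : T 0 = 0.
Proof.
have := congr1 (fun q : {poly {poly C}} => q`_0) darboux.
rewrite coef0_der_U [in RHS]cofactor_shape [in RHS]mulrDl coefD coefCM mulrnAl mulNr.
rewrite coefMn coefN coefXM oppr0 mul0rn add0r /T mulr0n mulr0 subr0 mulr1n => <-; ring.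
Qed.

Lemma coef_recurrence k : (k <= n)%N -> T k.+1 = P`_k *+ (n - k).
Proof.
move=> kn; have := congr1 (fun q : {poly {poly C}} => q`_k.+1) darboux.
rewrite coefS_der_U [in RHS]cofactor_shape [in RHS]mulrDl [RHS]coefD coefCM mulrnAl mulNr.
rewrite coefMn coefN coefXM /= mulNrn => /esym/eqP; rewrite addrC subr_eq => /eqP E.
by rewrite /T E mulrnBr //; ring.
Qed.

Let d := (size P`_n).-1.

(** The dominant term of T k is g P`_k: the contribution of (n + d) y to l is
    cancelled by the leading terms of the derivatives as long as e = 0, and has
    lower degree than g P`_k if e > 0. *)
Lemma size_recurrence (g : {poly C}) e k s : l = g + (n + d)%:R *: 'X -> size g = e.+2 ->
  (k <= n)%N -> s = (d + (n - k) * e.+1)%N ->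
  size P`_k = s.+1 -> leq (size P`_k.+1) s -> size (T k) = (s + e.+1).+1.
Proof.
move=> El sg kn Es sk sk1.
pose rest := 'X * (P`_k *+ (d + (n - k))) - 'X * ('X * (P`_k)^`()) + a *: ('X * (P`_k)^`())
  + a *: (P`_k *+ k) - ((41%:R * a / 144%:R) *: ('X * (P`_k.+1 *+ k.+1))
    - (2%:R * a ^+ 2 / 9%:R) *: (P`_k.+1 *+ k.+1)).
have -> : T k = g * P`_k + rest.
  have En : (n + d = (d + (n - k)) + k)%N by lia.
  have natP m (q : {poly C}) : q *+ m = m%:R%:P * q by rewrite mul_polyC scaler_nat.
  rewrite /T /rest El En /vel_y /vel_U0 !natP -!mul_polyC.
  move: (41%:R * a / 144%:R) (2%:R * a ^+ 2 / 9%:R) (P`_k) (P`_k.+1) => B G p q.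
  move: p^`() => p'; rewrite !natrD !polyCD; ring.
have sgP : size (g * P`_k)%R = (s + e.+1).+1.
  by rewrite size_mul -?size_poly_gt0 ?sg ?sk // !addnS addSn addnC addnS.
rewrite -sgP; apply: size_polyDl; rewrite sgP ltnS; apply/leq_sizeP => -[|m] hm.
  by rewrite addnS in hm.
rewrite /rest !(coefD, coefN, coefZ, coefMn, coefXM) /= -!coefXM !coefX_deriv coef_deriv.
have -> : P`_k`_m.+1 = 0 by rewrite nth_default // sk; lia.
have -> : P`_k.+1`_m.+1 = 0 by rewrite nth_default // (leq_trans sk1) //; lia.
have -> : P`_k.+1`_m = 0 by rewrite nth_default // (leq_trans sk1) //; lia.
rewrite !mul0rn !mulr0 !addr0 subr0 oppr0 addr0.
case: (ltnP s m) => [sm|ms].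
  by rewrite nth_default ?sk // !mul0rn subrr.
have -> : m = (d + (n - k))%N by nia.
by rewrite subrr.
Qed.

(** Otherwise l - (n + d) y has some degree e + 1 > 0. By the recurrence each
    coefficient of P then has degree e + 1 more than the following one, and the
    recurrence does not stop: T 0 has to be zero and is not. *)
Lemma cofactor_infinity : exists mu : C, l = mu%:P + (n + d)%:R *: 'X.
Proof.
pose g := l - (n + d)%:R *: 'X.
have El : l = g + (n + d)%:R *: 'X by rewrite subrK.
have [/size1_polyC sg|] := leqP (size g) 1; first by exists g`_0; rewrite -sg.
case E : (size g) => [|[|e]] // _.
have sP : size P = n.+1 by rewrite prednK ?size_poly_gt0.
have lP : P`_n != 0 by move: P0; rewrite -lead_coef_eq0 lead_coefE sP.
have sizes j : (j <= n)%N -> size P`_(n - j) = (d + j * e.+1).+1 /\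
    leq (size P`_(n - j).+1) (d + j * e.+1).
  elim: j => [|j IH] jn.
    rewrite subn0 mul0n addn0 prednK ?size_poly_gt0 //; split=> //.
    by rewrite nth_default ?sP // size_poly0.
  have [s1 s2] := IH (ltnW jn).
  have kn : (n - j <= n)%N by rewrite leq_subr.
  have Es : (d + j * e.+1 = d + (n - (n - j)) * e.+1)%N by rewrite subKn // ltnW.
  have := size_recurrence El E kn Es s1 s2.
  have Ej : (n - j)%N = (n - j.+1).+1 by lia.
  rewrite {1}Ej coef_recurrence ?leq_subr // subKn // -scaler_nat.
  rewrite size_scale ?pnatr_eq0 // => ->; rewrite -Ej s1 mulSn.
  by split; lia.
have [s1 s2] := sizes n (leqnn n).
rewrite subnn in s1 s2.
have := size_recurrence El E (leq0n n) (erefl _); rewrite subn0 => /(_ s1 s2).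
by rewrite coef_recurrence0 size_poly0.
Qed.

End Cofactor.

Hypothesis a0 : a != 0.

(** By [cofactor_infinity], l(a) - l(0) = (n + d) a. On y = 0 the quadratic [vel_U]
    has the roots -a/3 and -2a/3, and on y = a the roots -a/4 and a/4, so
    [fiber_cofactor] gives l(0) = - (n + i) a/3 and l(a) = (2 j - n) a/4. *)
Lemma darboux_U P : P != 0 -> P %| der_U P -> (size P <= 1)%N.
Proof.
move=> P0 dP; have [Q [sQ dQ prim]] := darboux_primitive_part P0 dP.
have [L E] := cofactor_poly dQ prim.
have Q0 : Q != 0 by rewrite -size_poly_eq0 sQ size_poly_eq0.
have [mu Emu] := cofactor_infinity Q0 E.
have fiber_vel z : fiber z vel_U = - ('X * 'X) + (z - a)%:P * 'X + (vel_U0.[z])%:P.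
  rewrite /fiber /vel_U 2!rmorphD rmorphN !rmorphM /= !map_polyX !map_polyC /=.
  by rewrite /horner_eval hornerD hornerN hornerX hornerC.
have fiber_factor z s r : z - a = s + r -> (vel_U0).[z] = - (s * r) ->
    fiber z vel_U = - (('X - s%:P) * ('X - r%:P)).
  by move=> e1 e2; rewrite fiber_vel e1 e2 polyCN polyCD polyCM; ring.
have v0 : vel_y.[0] = 0 by rewrite /vel_y !hornerE.
have va : vel_y.[a] = 0 by rewrite /vel_y !hornerE subrr mulr0.
have vel_U0E z : vel_U0.[z] = 41%:R * a / 144%:R * z - 2%:R * a ^+ 2 / 9%:R.
  by rewrite /vel_U0 hornerD hornerN hornerZ hornerX hornerC.
have e0 : fiber 0 vel_U = - (('X - (- a / 3%:R)%:P) * ('X - (- (2%:R * a) / 3%:R)%:P)).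
  by apply: fiber_factor; rewrite ?vel_U0E; field.
have ea : fiber a vel_U = - (('X - (- a / 4%:R)%:P) * ('X - (a / 4%:R)%:P)).
  by apply: fiber_factor; rewrite ?vel_U0E; field.
have [i le_i Ei] := fiber_cofactor Q0 E v0 (prim 0) e0.
have [j le_j Ej] := fiber_cofactor Q0 E va (prim a) ea.
have : 12%:R * ((L`_0).[a] - (L`_0).[0]) =
  a * (12%:R * ((size Q).-1 + (size Q`_(size Q).-1).-1)%:R).
  by rewrite Emu !(hornerD, hornerC, hornerZ, hornerX); ring.
rewrite Ei Ej.
set n := (size Q).-1 in le_i le_j *; set d := (_.-1).
have -> : 12%:R * (n%:R * (- a / 4%:R) - j%:R * (- a / 4%:R - a / 4%:R) -
    (n%:R * (- a / 3%:R) - i%:R * (- a / 3%:R - (- (2%:R * a)) / 3%:R))) =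
  a * (n + 6 * j + 4 * i)%N%:R.
  by rewrite 2!natrD !natrM; field.
move/(mulfI a0); rewrite -natrM => /eqP; rewrite eqr_nat => /eqP E2.
have n0 : n = 0%N by lia.
by move: n0; rewrite /n sQ; case: (size P) => [|[]].
Qed.

End Riccati.

(** * The variables s and t *)
Lemma dvdp_size_scale (R : idomainType) (P Q : {poly R}) :
  P != 0 -> P %| Q -> (size Q <= size P)%N ->
  exists2 c, c != 0 & exists l, c *: Q = l *: P.
Proof.
move=> P0 /dvdpP[[c L] /= c0 E] sQ; exists c => //.
have sL : (size L <= 1)%N.
  have [->|L0] := eqVneq L 0; first by rewrite size_poly0.
  have := size_scale Q c0; rewrite E size_mul // => h.
  rewrite -(leq_add2r (size P)) add1n; move: sQ; rewrite -h.
  by move: P0; rewrite -size_poly_gt0; case: (size L + size P)%N.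
by exists L`_0; rewrite E {1}(size1_polyC sL) mul_polyC.
Qed.

Section Tower.
Variables (C : numClosedFieldType) (a : C).
Hypothesis a0 : a != 0.
Local Notation der_U := (der_U a).
Local Notation derU := (derivation_U a).

(** The logarithmic derivative of s = y (y - a) / y'. *)
Definition tau : {poly {poly C}} := ('X - a%:P)%:P - 'X *+ 2.
Definition vel_s : {poly {poly {poly C}}} := tau%:P * 'X.
Definition der_s := poly_der der_U vel_s.
Lemma derivation_s : derivation der_s. Proof. exact/poly_derP/derU. Qed.
Definition vel_t : {poly {poly {poly {poly C}}}} := 'X%:P.
Definition der_t := poly_der der_s vel_t.

Lemma coef_der_s P k : (der_s P)`_k = der_U P`_k + tau * (P`_k *+ k).
Proof. by rewrite (coef_poly_der derU) /vel_s -mulrA coefCM coefX_deriv. Qed.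

Lemma coef_tauM q k : (tau * q)`_k.+1 = ('X - a%:P) * q`_k.+1 - q`_k *+ 2.
Proof. by rewrite /tau mulrBl mulrnAl coefB coefMn coefCM coefXM. Qed.

Lemma coef_der_t P k : (der_t P)`_k = der_s P`_k + 'X * (P`_k.+1 *+ k.+1).
Proof. by rewrite (coef_poly_der derivation_s) /vel_t coefCM coef_deriv. Qed.

Lemma der_UC (c : {poly C}) : der_U c%:P = (der_y a c)%:P.
Proof. exact/poly_derC/derivation_y. Qed.

(** Numerator and denominator of a reduced solution h of h' = - M tau h divide
    their derivatives, hence are free of U, whereas tau has degree 1 in U. *)
Lemma no_exponential M (f g : {poly {poly C}}) :
  f != 0 -> g != 0 -> solves der_U (- tau *+ M) 0 f g -> M = 0%N.
Proof.
move=> f0 g0 /(solves_reduced derU g0)[f1 [g1 [g10 E cop sol dg1]]].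
have df1 := solves0_dvd sol cop.
have f10 : f1 != 0.
  by apply/eqP=> h; move/eqP: E; rewrite h mul0r mulf_eq0 (negPf f0) (negPf g10).
have := size1_polyC (darboux_U a0 f10 df1); have := size1_polyC (darboux_U a0 g10 dg1).
move: f1`_0 g1`_0 => c e Eg Ef; move: f10 g10 sol; rewrite Ef Eg !polyC_eq0 => c0 e0.
rewrite /solves !der_UC -!polyCM -polyCB mul0r addr0.
move/(congr1 (fun q : {poly {poly C}} => q`_1)); rewrite coefC /= mulrnAl mulNr coefCM.
rewrite coefMn coefN coef_tauM !coefC /= mulr0 sub0r opprK => /esym/eqP.
rewrite mulf_eq0 (negPf e0) -mulrnA -mulr_natl mulf_eq0 (negPf c0) orbF.
by rewrite /= -polyC_natr polyC_eq0 pnatr_eq0 muln_eq0 => /eqP.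
Qed.

(** A reduced solution h of h' = - tau h - M has a denominator free of U. If the
    numerator has degree r in U, the term of degree r + 1 in h' + tau h has the
    factor - (r + 2), so it does not vanish. *)
Lemma no_affine_exponential M (f g : {poly {poly C}}) :
  g != 0 -> solves der_U (- tau) (- M%:R) f g -> M = 0%N.
Proof.
move=> g0 /(solves_reduced derU g0)[f1 [g1 [g10 E cop sol dg1]]].
have := size1_polyC (darboux_U a0 g10 dg1).
move: g1`_0 => e Eg; move: g10 sol; rewrite Eg polyC_eq0 => e0.
rewrite /solves der_UC.
have [->|f10] := eqVneq f1 0.
  rewrite (der0 derU) mul0r !mulr0 subr0 add0r => /esym/eqP.
  rewrite mulf_eq0 polyC_eq0 (negPf e0) mulNr oppr_eq0 mulf_eq0 polyC_eq0 (negPf e0) orbF.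
  by rewrite /= -!polyC_natr !polyC_eq0 pnatr_eq0 => /eqP.
have [r Er] : exists r, size f1 = r.+1 by exists (size f1).-1; rewrite prednK ?size_poly_gt0.
have lr : f1`_r != 0 by move: f10; rewrite -lead_coef_eq0 lead_coefE Er.
move/(congr1 (fun q : {poly {poly C}} => q`_r.+1)).
rewrite coefB [in LHS]coefCM coefMC [in RHS]coefCM [in RHS]coefD !mulNr !coefN coef_tauM coefS_der_U.
rewrite mulr_natl coefMn coefC /= mul0rn oppr0.
rewrite ![f1`_r.+1]nth_default ?[f1`_r.+2]nth_default ?Er // deriv0 !mul0rn !mulr0 mul0r.
rewrite !addr0 add0r subr0 sub0r opprK => /(mulfI e0)/eqP.
rewrite eq_sym -subr_eq0 opprK -mulrnDr -mulr_natl mulf_eq0 (negPf lr) orbF.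
by rewrite -polyC_natr polyC_eq0 pnatr_eq0.
Qed.

(** The quotient of two coefficients g_k and g_j would solve
    h' = - (k - j) tau h. *)
Lemma darboux_s (g : {poly {poly {poly C}}}) : g != 0 -> g %| der_s g ->
  exists k c, g = c%:P * 'X^k.
Proof.
move=> g0 dg.
have [c c0 [l E]] : exists2 c, c != 0 & exists l, c *: der_s g = l *: g.
  apply: dvdp_size_scale => //; apply/leq_sizeP => i hi.
  by rewrite coef_der_s nth_default // (der0 derU) mul0rn mulr0 addr0.
exists (size g).-1, (lead_coef g); set k := (size g).-1.
apply/polyP=> j; rewrite coefCM coefXn lead_coefE -/k.
have [->|jk] := eqVneq j k; first by rewrite mulr1.
rewrite mulr0; have [jlt|] := ltnP j k; last first.
  rewrite leq_eqVlt eq_sym (negPf jk) /= => kj; rewrite nth_default //.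
  by move: kj; rewrite /k; case: (size g).
apply/eqP; apply: contraT => gj0.
have gk0 : g`_k != 0 by rewrite -lead_coefE lead_coef_eq0.
suff /eqP : (k - j = 0)%N by rewrite subn_eq0 leqNgt jlt.
apply: (no_exponential gk0 gj0); rewrite /solves mul0r addr0; apply: (mulfI c0).
have := congr1 (fun q : {poly {poly {poly C}}} => q`_k) E.
have := congr1 (fun q : {poly {poly {poly C}}} => q`_j) E.
rewrite !coefZ !coef_der_s.
have -> : k = (j + (k - j))%N by rewrite subnKC // ltnW.
rewrite addKn; move: (k - j)%N gk0 => m _ Ej Ek.
have -> : c * (g`_j * der_U g`_(j + m) - g`_(j + m) * der_U g`_j) =
   g`_j * (c * (der_U g`_(j + m) + tau * (g`_(j + m) *+ (j + m))))
  - g`_(j + m) * (c * (der_U g`_j + tau * (g`_j *+ j)))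
  - g`_j * (c * (tau * g`_(j + m) *+ m)).
  rewrite mulrnDr; ring.
by rewrite Ej Ek; ring.
Qed.

(** By [darboux_s] the reduced denominator of a solution of h' = - M s is c s^k, so h
    is a Laurent polynomial in s; its coefficient h1 of s^1 satisfies
    h1' + tau h1 = - M. *)
Lemma no_antiderivative M (f g : {poly {poly {poly C}}}) :
  g != 0 -> solves der_s 0 (- 'X *+ M) f g -> M = 0%N.
Proof.
move=> g0 /(solves_reduced derivation_s g0)[f1 [g1 [g10 _ _ sol dg1]]].
have [k [c Ec]] := darboux_s g10 dg1.
have c0 : c != 0 by apply: contraNneq g10 => h; rewrite Ec h mul0r.
apply: (@no_affine_exponential M f1`_k.+1 c c0).
move: sol; rewrite /solves mul0r add0r.
have -> : der_s g1 = (der_U c + tau * (c *+ k))%:P * 'X^k.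
  apply/polyP=> i; rewrite coef_der_s Ec !coefCM coefXn.
  case: eqP => [->|_]; rewrite ?mulr1 // !mulr0 (der0 derU) mul0rn mulr0 addr0 //.
move/(congr1 (fun q : {poly {poly {poly C}}} => q`_(k + k.+1))).
have coefCXM (e : {poly {poly C}}) Q i : (e%:P * 'X^k * Q)`_(k + i) = e * Q`_i.
  by rewrite -mulrA coefCM coefXnM ltnNge leq_addr addKn.
rewrite coefB [f1 * _]mulrC Ec !coefCXM coef_der_s => E.
have {}E : c * (der_U f1`_k.+1 + tau * (f1`_k.+1 *+ k.+1)) -
    (der_U c + tau * (c *+ k)) * f1`_k.+1 = c * (- (c *+ M)).
  rewrite E mulrnAl mulNr coefMn coefN coefXM /= coefCM coefXn eqxx mulr1.
  by rewrite mulNrn.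
have -> : c * der_U f1`_k.+1 - f1`_k.+1 * der_U c =
  c * (der_U f1`_k.+1 + tau * (f1`_k.+1 *+ k.+1)) -
    (der_U c + tau * (c *+ k)) * f1`_k.+1 - c * tau * f1`_k.+1.
  rewrite mulrS; ring.
by rewrite E -[c *+ M]mulr_natl; ring.
Qed.

(** The two highest coefficients f and g of P would satisfy (f / g)' = - m s, where
    m is the degree of P in t. *)
Lemma darboux_t (P : {poly {poly {poly {poly C}}}}) : P != 0 -> P %| der_t P ->
  (size P <= 1)%N.
Proof.
move=> P0 dP.
have [c c0 [l E]] : exists2 c, c != 0 & exists l, c *: der_t P = l *: P.
  apply: dvdp_size_scale => //; apply/leq_sizeP => i hi.
  rewrite coef_der_t !nth_default // ?leqW //.
  by rewrite (der0 derivation_s) mul0rn mulr0 addr0.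
case Em : (size P) => [|[|m]] //.
have lP : P`_m.+1 != 0 by move: P0; rewrite -lead_coef_eq0 lead_coefE Em.
suff : m.+1 = 0%N by [].
apply: (@no_antiderivative _ P`_m P`_m.+1) => //; rewrite /solves mul0r add0r.
have := congr1 (fun q : {poly {poly {poly {poly C}}}} => q`_m) E.
have := congr1 (fun q : {poly {poly {poly {poly C}}}} => q`_m.+1) E.
rewrite !coefZ !coef_der_t [P`_m.+2]nth_default ?Em // mul0rn mulr0 addr0.
move=> E1 E2; apply: (mulfI c0).
have -> : c * (P`_m.+1 * der_s P`_m - P`_m * der_s P`_m.+1) =
  P`_m.+1 * (c * (der_s P`_m + 'X * (P`_m.+1 *+ m.+1))) - P`_m * (c * der_s P`_m.+1)
  - c * P`_m.+1 * ('X * (P`_m.+1 *+ m.+1)) by ring.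
by rewrite E1 E2 mulrnAr mulrnAl mulNr; ring.
Qed.

End Tower.

(** * Algebraic independence along a solution *)
Section Independence.
Variables (C : numClosedFieldType) (a : C).
Hypothesis a0 : a != 0.

Definition ev_y (y : C) : {rmorphism {poly C} -> C} := eval_ext idfun y.
Definition ev_U (y U : C) := eval_ext (ev_y y) U.
Definition ev_s (y U s : C) := eval_ext (ev_U y U) s.
Definition ev_t (y U s t : C) := eval_ext (ev_s y U s) t.

Variables (y U s t : C).
Hypotheses (y0 : (vel_y a).[y] != 0) (s0 : s != 0).

(** C is algebraically closed, so a flat polynomial in y has a flat factor y - z,
    whose derivative is y (y - a). *)
Lemma flat_y_trivial c : flat (der_y a) (ev_y y) c -> c = 0.
Proof.
move=> fc; apply/eqP; apply: contraT => c0.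
have [n] := ubnP (size c); elim: n c fc c0 => // n IH c fc c0 sc.
have [/size_poly1P[k k0 Ek]|c1] := boolP (size c == 1)%N.
  by move: (fc 0%N) k0; rewrite Ek eval_extC /= => ->; rewrite eqxx.
have /closed_rootP[z /rootP/polyXsubCP cz] := c1.
have Ec : c = c %/ ('X - z%:P) * ('X - z%:P) by apply/eqP; rewrite eqp_div_XsubC.
set c' := _ %/ _ in Ec.
have c'0 : c' != 0 by apply: contraNneq c0 => h; rewrite Ec h mul0r.
move: fc; rewrite Ec => /(flat_prime (derivation_y a)) [fc'|fz].
  apply: (IH c') => //.
  by move: sc; rewrite Ec size_mul ?polyXsubC_eq0 // size_XsubC addn2.
have := fz 1%N; rewrite /= der_yE derivXsubC mulr1 map_poly_id // => h.
by move: y0; rewrite -[_.[y]]/(horner_eval y (vel_y a)) h eqxx.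
Qed.

Lemma flat_U_trivial P : flat (der_U a) (ev_U y U) P -> P = 0.
Proof.
move=> fP; apply/eqP; apply: contraT => P0.
have [Q [_ sQ dQ]] := flat_minimal (derivation_y a) flat_y_trivial fP P0.
have Q0 : Q != 0 by rewrite -size_poly_gt0 ltnW.
by have := darboux_U a0 Q0 dQ; rewrite leqNgt sQ.
Qed.

Lemma flat_s_trivial P : flat (der_s a) (ev_s y U s) P -> P = 0.
Proof.
move=> fP; apply/eqP; apply: contraT => P0.
have [Q [fQ sQ dQ]] := flat_minimal (derivation_U a) flat_U_trivial fP P0.
have Q0 : Q != 0 by rewrite -size_poly_gt0 ltnW.
have [k [c Ec]] := darboux_s a0 Q0 dQ; move: fQ; rewrite Ec.
case/(flat_prime (derivation_s a)) => [/(flatC (derivation_U a))/flat_U_trivial c0|].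
  by rewrite Ec c0 mul0r eqxx in Q0.
elim: k {Ec} => [|k IH].
  by move/(_ 0%N); rewrite expr0 rmorph1 => /eqP; rewrite oner_eq0.
rewrite exprS => /(flat_prime (derivation_s a)) [/(_ 0%N)|//].
by rewrite eval_extX => /eqP; rewrite (negPf s0).
Qed.

Theorem flat_t_trivial P : flat (der_t a) (ev_t y U s t) P -> P = 0.
Proof.
move=> fP; apply/eqP; apply: contraT => P0.
have [Q [_ sQ dQ]] := flat_minimal (derivation_s a) flat_s_trivial fP P0.
have Q0 : Q != 0 by rewrite -size_poly_gt0 ltnW.
by have := darboux_t a0 Q0 dQ; rewrite leqNgt sQ.
Qed.

End Independence.

(** * A norm on polynomials *)
Lemma mpoly_ring_ind (n : nat) (R : comNzRingType) (Q : mpoly n R -> Prop) :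
  (forall c, Q (mpolyC n c)) -> (forall i, Q (mpolyX R (mnm1 i))) ->
  (forall p q, Q p -> Q q -> Q (p + q)) -> (forall p q, Q p -> Q q -> Q (p * q)) ->
  forall p, Q p.
Proof.
move=> hC hX hD hM p; elim/mpolyind: p => [|c m p _ _ hp]; first exact: hC 0.
apply: (hD _ _) => //; rewrite -mul_mpolyC; apply: (hM _ _) => //.
rewrite mpolyXE_id; apply: (big_ind Q) => [||i _]; [exact: hC 1|by move=> x y hx hy; apply: (hM _ _)|].
by elim: (m i) => [|k IH]; [exact: hC 1|rewrite exprS; apply: (hM _ _)].
Qed.

Section PolyNorm.
Variables (C : numFieldType) (rho : C).
Hypothesis rho0 : 0 <= rho.
Implicit Types (p q : {poly C}).

(** The sum of |p_i| rho^i; it bounds p on the disc of radius rho. *)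
Definition pnorm p : C := (map_poly (fun x : C => `|x|) p).[rho].

Lemma pnormE n p : (size p <= n)%N -> pnorm p = \sum_(i < n) `|p`_i| * rho ^+ i.
Proof.
move=> sp; rewrite /pnorm (@horner_coef_wide _ n) ?(leq_trans (size_poly _ _)) //.
by apply: eq_bigr => i _; rewrite coef_map_id0 ?normr0.
Qed.

Lemma pnorm_ge0 p : 0 <= pnorm p.
Proof.
rewrite (pnormE (leqnn _)); apply: sumr_ge0 => i _.
by rewrite mulr_ge0 // exprn_ge0.
Qed.

Lemma pnormD p q : pnorm (p + q) <= pnorm p + pnorm q.
Proof.
pose n := maxn (size p) (size q).
rewrite (@pnormE n) ?size_polyD // !(@pnormE n) ?leq_maxl ?leq_maxr //.
rewrite -big_split /=; apply: ler_sum => i _.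
by rewrite coefD -mulrDl ler_wpM2r ?exprn_ge0 // ler_normD.
Qed.

Lemma pnormC c : pnorm c%:P = `|c|.
Proof. by rewrite (@pnormE 1) ?size_polyC_leq1 // big_ord1 coefC mulr1. Qed.

Lemma pnormMXaddC p c : pnorm (p * 'X + c%:P) = pnorm p * rho + `|c|.
Proof.
rewrite /pnorm (_ : map_poly _ _ = map_poly (fun x => `|x|) p * 'X + `|c|%:P).
  by rewrite hornerMXaddC.
apply/polyP=> i; rewrite coef_map_id0 ?normr0 // !coefD !coefMX !coefC.
by rewrite coef_map_id0 ?normr0 //; case: i => [|i]; rewrite /= ?add0r ?addr0.
Qed.

Lemma pnormM p q : pnorm (p * q) <= pnorm p * pnorm q.
Proof.
elim/poly_ind: p => [|p c IH].
  by rewrite mul0r -polyC0 pnormC normr0 mul0r.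
rewrite pnormMXaddC mulrDl [leRHS]mulrDl mulrAC.
apply: (le_trans (pnormD _ _)); apply: lerD.
  rewrite -[_ * 'X]addr0 -polyC0 pnormMXaddC normr0 addr0 mulrAC.
  by rewrite ler_wpM2r.
rewrite mul_polyC (@pnormE (size q)) ?size_scale_leq // (pnormE (leqnn _)).
by rewrite mulr_sumr le_eqVlt; apply/orP; left; apply/eqP/eq_bigr => i _; rewrite coefZ normrM mulrA.
Qed.

Lemma horner_le_pnorm p z : `|z| <= rho -> `|p.[z]| <= pnorm p.
Proof.
move=> zr; elim/poly_ind: p => [|p c IH]; first by rewrite horner0 normr0 pnorm_ge0.
rewrite hornerMXaddC pnormMXaddC (le_trans (ler_normD _ _)) // lerD2r normrM.
by apply: ler_pM.
Qed.

Definition integ p : {poly C} :=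
  \poly_(i < (size p).+1) (if i is k.+1 then p`_k / k.+1%:R else 0).

Lemma coef_integ0 p : (integ p)`_0 = 0.
Proof. by rewrite coef_poly. Qed.

Lemma coef_integS p k : (integ p)`_k.+1 = p`_k / k.+1%:R.
Proof.
by rewrite coef_poly ltnS; case: ltnP => // h; rewrite nth_default // mul0r.
Qed.

Lemma deriv_integ p : (integ p)^`() = p.
Proof.
apply/polyP=> i; rewrite coef_deriv coef_integS -[_ *+ i.+1]mulr_natr divfK //.
by rewrite pnatr_eq0.
Qed.

Lemma integB p q : integ (p - q) = integ p - integ q.
Proof.
apply/polyP=> -[|i]; first by rewrite coefB !coef_integ0 subrr.
by rewrite coefB !coef_integS coefB mulrBl.
Qed.

Lemma pnorm_integ p : pnorm (integ p) <= rho * pnorm p.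
Proof.
rewrite (@pnormE (size p).+1) ?size_poly // big_ord_recl coef_integ0 normr0 mul0r add0r.
rewrite (pnormE (leqnn _)) mulr_sumr; apply: ler_sum => i _.
rewrite lift0 coef_integS exprS mulrCA ler_wpM2l // ler_wpM2r ?exprn_ge0 //.
rewrite normrM normfV normr_nat ler_pdivrMr ?ltr0n // ler_peMr //.
by rewrite ler1n.
Qed.

(** The recursion (p X + c)' = p + p' X gives this Cauchy estimate without
    contour integrals. *)
Lemma deriv_bound p z : `|z| <= rho / 2 -> rho / 2 * `|p^`().[z]| <= pnorm p.
Proof.
move=> zr.
have r0 : 0 <= rho / 2 by rewrite divr_ge0.
have zr' : `|z| <= rho by rewrite (le_trans zr) // ler_pdivrMr // ler_peMr // ler1n.
elim/poly_ind: p => [|p c IH]; first by rewrite derivC horner0 normr0 mulr0 pnorm_ge0.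
rewrite derivMXaddC hornerD hornerMX pnormMXaddC ler_wpDr //.
have -> : pnorm p * rho = rho / 2 * pnorm p + rho / 2 * pnorm p by field.
apply: (@le_trans _ _ (rho / 2 * (`|p.[z]| + `|p^`().[z]| * `|z|))).
  by rewrite ler_wpM2l // -normrM ler_normD.
rewrite mulrDr; apply: lerD; first by rewrite ler_wpM2l ?horner_le_pnorm.
by rewrite mulrA mulrC ler_pM // mulr_ge0.
Qed.

(** The remainder E of p yields the remainder (z + h) E + h^2 p'(z) of p X + c. *)
Lemma taylor_bound p z h : `|z| <= rho / 2 -> `|z + h| <= rho / 2 ->
  (rho / 2) ^+ 2 * `|p.[z + h] - p.[z] - h * p^`().[z]| <= `|h| ^+ 2 * pnorm p.
Proof.
move=> zr zhr; have r0 : 0 <= rho / 2 by rewrite divr_ge0.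
elim/poly_ind: p => [|p c IH].
  by rewrite derivC !horner0 mulr0 !subr0 normr0 mulr0 mulr_ge0 ?exprn_ge0 ?pnorm_ge0.
set E := p.[z + h] - _ - _ in IH.
have -> : (p * 'X + c%:P).[z + h] - (p * 'X + c%:P).[z] - h * (p * 'X + c%:P)^`().[z]
   = (z + h) * E + h ^+ 2 * p^`().[z].
  by rewrite derivMXaddC !hornerMXaddC hornerD hornerMX /E; ring.
move: E IH => E IH; rewrite pnormMXaddC mulrDr ler_wpDr ?mulr_ge0 ?exprn_ge0 //.
have -> : `|h| ^+ 2 * (pnorm p * rho) =
  rho / 2 * (`|h| ^+ 2 * pnorm p) + rho / 2 * (`|h| ^+ 2 * pnorm p) by field.
apply: (@le_trans _ _ ((rho / 2) ^+ 2 * (`|z + h| * `|E| + `|h| ^+ 2 * `|p^`().[z]|))).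
  rewrite ler_wpM2l ?exprn_ge0 // (le_trans (ler_normD _ _)) //.
  by rewrite !normrM -expr2.
rewrite mulrDr lerD //.
  by rewrite mulrCA ler_pM // mulr_ge0 ?exprn_ge0.
rewrite expr2 -mulrA ler_wpM2l // mulrCA ler_wpM2l ?exprn_ge0 //.
exact: deriv_bound.
Qed.

End PolyNorm.

Section Lipschitz.
Variables (C : numFieldType) (n : nat).

(** Substitution of polynomials u_i for the variables of P. *)
Definition psubst (u : 'I_n -> {poly C}) (P : mpoly n C) : {poly C} := mmap (@polyC C) u P.

Lemma horner_psubst u P z : (psubst u P).[z] = meval (fun i => (u i).[z]) P.
Proof.
elim/mpoly_ring_ind: P => [c|i|p q hp hq|p q hp hq].
- by rewrite /psubst mmapC mevalC hornerC.
- by rewrite /psubst mmapX mmap1U mevalXU.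
- by rewrite /psubst rmorphD hornerD mevalD -hp -hq.
- by rewrite /psubst rmorphM hornerM mevalM -hp -hq.
Qed.

(** The constant does not depend on the radius rho, so the radius may be chosen
    in terms of it. *)
Definition lipschitz_const (M : C) (P : mpoly n C) (L : C) : Prop :=
  forall (rho : C) (u w : 'I_n -> {poly C}) (e : C),
    0 <= rho -> 0 <= e ->
    (forall i, pnorm rho (u i) <= M) -> (forall i, pnorm rho (w i) <= M) ->
    (forall i, pnorm rho (u i - w i) <= e) ->
    pnorm rho (psubst u P) <= L /\ pnorm rho (psubst u P - psubst w P) <= L * e.

Lemma psubst_lipschitz (P : mpoly n C) (M : C) : 0 <= M ->
  exists2 L : C, 0 <= L & lipschitz_const M P L.
Proof.
move=> M0; elim/mpoly_ring_ind: P => [c|i|p q [L1 L10 H1] [L2 L20 H2]|p q [L1 L10 H1] [L2 L20 H2]].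
- exists `|c| => // rho u w e r0 e0 hu hw huw; rewrite /psubst !mmapC subrr -polyC0.
  by rewrite !pnormC // normr0 mulr_ge0.
- exists (M + 1) => [|rho u w e r0 e0 hu hw huw]; first by rewrite addr_ge0.
  rewrite /psubst !mmapX !mmap1U; split; first by rewrite (le_trans (hu i)) // lerDl.
  by rewrite (le_trans (huw i)) // mulrDl mul1r ler_wpDl // mulr_ge0.
- exists (L1 + L2) => [|rho u w e r0 e0 hu hw huw]; first by rewrite addr_ge0.
  have [a1 b1] := H1 _ _ _ _ r0 e0 hu hw huw.
  have [a2 b2] := H2 _ _ _ _ r0 e0 hu hw huw.
  rewrite /psubst !rmorphD; split.
    by rewrite (le_trans (pnormD _ _ _)) // lerD.
  by rewrite opprD addrACA mulrDl (le_trans (pnormD _ _ _)) // lerD.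
- exists (L1 * L2 + L1 * L2) => [|rho u w e r0 e0 hu hw huw]; first by rewrite addr_ge0 ?mulr_ge0.
  have [a1 b1] := H1 _ _ _ _ r0 e0 hu hw huw.
  have [a2 b2] := H2 _ _ _ _ r0 e0 hu hw huw.
  have [|a2' _] := H2 _ w w _ r0 e0 hw hw.
    by move=> i; rewrite subrr -polyC0 pnormC // normr0.
  rewrite /psubst !rmorphM -!/(psubst _ _); split.
    rewrite (le_trans (pnormM _ _ _)) // ler_wpDr ?mulr_ge0 //.
    by rewrite ler_pM ?pnorm_ge0.
  have -> : psubst u p * psubst u q - psubst w p * psubst w q =
    psubst u p * (psubst u q - psubst w q) + (psubst u p - psubst w p) * psubst w q.
    by ring.
  rewrite (le_trans (pnormD _ _ _)) // [leRHS]mulrDl lerD //.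
    rewrite (le_trans (pnormM _ _ _)) // -mulrA ler_pM ?pnorm_ge0 //.
  rewrite (le_trans (pnormM _ _ _)) // mulrAC ler_pM ?pnorm_ge0 //.
Qed.

Lemma psubst_lipschitz_family (F : 'I_n -> mpoly n C) (M : C) : 0 <= M ->
  exists2 L : C, 0 < L & forall i, lipschitz_const M (F i) L.
Proof.
move=> M0.
have [L HL] := choice (fun i => (fun '(ex_intro2 L a b) =>
  ex_intro (fun L => 0 <= L /\ lipschitz_const M (F i) L) L (conj a b))
  (psubst_lipschitz (F i) M0)).
exists (\sum_i L i + 1) => [|i rho u w e r0 e0 hu hw huw].
  by rewrite ltr_wpDl // sumr_ge0 // => i _; have [] := HL i.
have [Li0 /(_ rho u w e r0 e0 hu hw huw) [h1 h2]] := HL i.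
have le : L i <= \sum_i L i + 1.
  rewrite (bigD1 i) //= -addrA lerDl addr_ge0 // sumr_ge0 // => j _.
  by have [] := HL j.
by split; [apply: le_trans le|rewrite (le_trans h2) // ler_wpM2r].
Qed.

(** Constant polynomials and rho = 0 turn the estimate for polynomials into one
    for values. *)
Lemma meval_lipschitz (P : mpoly n C) (M L e : C) (x y : 'I_n -> C) :
  lipschitz_const M P L -> 0 <= e -> (forall i, `|x i| <= M) -> (forall i, `|y i| <= M) ->
  (forall i, `|x i - y i| <= e) -> `|meval x P - meval y P| <= L * e.
Proof.
have E v : psubst (fun i => (v i)%:P) P = (meval v P)%:P.
  elim/mpoly_ring_ind: P => [c|i|P Q hP hQ|P Q hP hQ].
  - by rewrite /psubst mmapC mevalC.
  - by rewrite /psubst mmapX mmap1U mevalXU.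
  - by rewrite /psubst rmorphD mevalD polyCD -hP -hQ.
  - by rewrite /psubst rmorphM mevalM polyCM -hP -hQ.
move=> lip e0 hx hy hxy.
have [] := lip 0 (fun i => (x i)%:P) (fun i => (y i)%:P) e (lexx _) e0.
- by move=> i; rewrite pnormC.
- by move=> i; rewrite pnormC.
- by move=> i; rewrite -polyCB pnormC.
- by move=> _; rewrite !E -polyCB pnormC.
Qed.

End Lipschitz.

(** * Geometric convergence in the complex numbers *)
Section Complex.
Variable R : realType.
Local Notation C := R[i].

Lemma geometric_small (e b : C) : 0 < e -> 0 <= b -> exists k : nat, b / 2 ^+ k < e.
Proof.
case: e => er ei; case: b => br bi; rewrite ltcE lecE /= => /andP[/eqP-> e0] /andP[/eqP-> b_neq0].
have [k hk] : exists k : nat, br / er < 2 ^+ k.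
  exists (Num.bound (br / er)); apply: (@lt_trans _ _ (Num.bound (br / er))%:R).
    by apply: archi_boundP; rewrite divr_ge0 // ltW.
  by rewrite -natrX ltr_nat ltn_expl.
exists k; rewrite ltr_pdivrMr ?exprn_gt0 //.
have -> : (2 ^+ k : C) = (2 ^+ k)%:C%C by rewrite rmorphXn rmorph_nat.
rewrite ltcE; simpc => /=.
by rewrite mulrC -ltr_pdivrMr.
Qed.

Lemma le_geometric (x b c : C) : 0 <= x -> 0 <= b -> 0 <= c ->
  (forall k : nat, x <= b + c / 2 ^+ k) -> x <= b.
Proof.
move=> x0 b_neq0 c0 h; rewrite real_leNgt ?ger0_real //; apply/negP => bx.
have e0 : 0 < x - b by rewrite subr_gt0.
have [k] := geometric_small e0 c0; rewrite ltrBrDl => hk.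
by have := lt_le_trans hk (h k); rewrite ltxx.
Qed.

(** The intervals [s_k - 2/2^k, s_k + 2/2^k] are nested, so the supremum of their
    left ends lies in all of them. *)
Lemma real_geometric_limit (s : nat -> R) :
  (forall k, `|s k.+1 - s k| <= (2 ^+ k)^-1) ->
  exists l, forall k, `|s k - l| <= 2 / 2 ^+ k.
Proof.
move=> hs; pose e (k : nat) : R := 2 / 2 ^+ k.
have eS k : e k = (2 ^+ k)^-1 + e k.+1.
  rewrite /e exprS invfM mulrA divff ?mul1r ?pnatr_eq0 //.
  by rewrite mulrDl mul1r.
have mono k m : (k <= m)%N -> `|s m - s k| <= e k - e m.
  move=> /subnK <-; elim: (m - k)%N => [|j IH]; first by rewrite !subrr normr0.
  rewrite addSn -(subrKA (s (j + k)%N)) (le_trans (ler_normD _ _)) //.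
  rewrite (eS (j + k)%N) in IH; have := hs (j + k)%N; lra.
have e_ge0 k : 0 <= e k by rewrite divr_ge0 // exprn_ge0.
have cross k m : s k - e k <= s m + e m.
  have := e_ge0 k; have := e_ge0 m.
  have [/mono|/ltnW/mono] := leqP k m; rewrite ler_norml => /andP[]; lra.
pose A := [set s k - e k | k in [set: nat]].
have hA : has_sup A.
  split; first by exists (s 0%N - e 0%N), 0%N.
  by exists (s 0%N + e 0%N) => _ [k _ <-].
exists (sup A) => k; rewrite ler_norml; apply/andP; split.
  have : sup A <= s k + e k by apply: ge_sup; [case: hA|move=> _ [m _ <-]].
  rewrite /e; lra.
have : s k - e k <= sup A by apply: sup_upper_bound => //; exists k.
rewrite /e; lra.
Qed.

Lemma normc_le_ReIm (z : C) : `|z| <= (`|complex.Re z| + `|complex.Im z|)%:C%C.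
Proof.
case: z => x y; rewrite normc_def /= lecR.
rewrite -[leRHS]ger0_norm ?addr_ge0 // -sqrtr_sqr ler_sqrt ?sqr_ge0 //.
rewrite -(real_normK (num_real x)) -(real_normK (num_real y)).
have := mulr_ge0 (normr_ge0 x) (normr_ge0 y); nra.
Qed.

Lemma normc_Im_le (z : C) : `|complex.Im z|%:C%C <= `|z|.
Proof.
case: z => x y; rewrite normc_def /= lecR -sqrtr_sqr ler_sqrt ?addr_ge0 ?sqr_ge0 //.
by rewrite lerDr sqr_ge0.
Qed.

Lemma geometric_limit (w : nat -> C) :
  (forall k, `|w k.+1 - w k| <= (2 ^+ k)^-1) ->
  exists l, forall k, `|w k - l| <= 4 / 2 ^+ k.
Proof.
have E k : ((2 ^+ k)^-1 : C) = ((2 ^+ k)^-1)%:C%C.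
  by rewrite fmorphV rmorphXn rmorph_nat.
move=> hw.
have [lr Hr] : exists l, forall k, `|complex.Re (w k) - l| <= 2 / 2 ^+ k.
  apply: real_geometric_limit => k; rewrite -lecR -E (le_trans _ (hw k)) //.
  by rewrite (le_trans _ (normc_ge_Re _)) // lecR raddfB.
have [li Hi] : exists l, forall k, `|complex.Im (w k) - l| <= 2 / 2 ^+ k.
  apply: real_geometric_limit => k; rewrite -lecR -E (le_trans _ (hw k)) //.
  by rewrite (le_trans _ (normc_Im_le _)) // lecR raddfB.
exists (lr +i* li)%C => k; rewrite (le_trans (normc_le_ReIm _)) // !raddfB /=.
have -> : (4 / 2 ^+ k : C) = (4 / 2 ^+ k)%:C%C by rewrite E -(rmorph_nat (real_complex R)) -rmorphM.
rewrite lecR; have := Hr k; have := Hi k; lra.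
Qed.

End Complex.

(** * Solutions of polynomial differential equations *)
Lemma is_derive_quadratic (K : numFieldType) (f : K -> K) (z df r c : K) :
  0 < r -> 0 <= c ->
  (forall h, `|h| < r -> `|f (z + h) - f z - h * df| <= c * `|h| ^+ 2) ->
  is_derive z 1 f df.
Proof.
move=> r0 c0 H.
have cv : (fun h => h^-1 *: ((f \o shift z) (h *: (1 : K)) - f z)) @ 0^' --> df.
  apply/cvgrPdist_le => e e0; near=> h.
  have h0 : h != 0 by near: h; exact: nbhs_dnbhs_neq.
  have hr : `|h| < r by near: h; apply: dnbhs0_lt.
  have he : `|h| < e / (c + 1) by near: h; apply: dnbhs0_lt; rewrite divr_gt0 // ltr_wpDl.
  have -> : df - h^-1 *: ((f \o shift z) (h *: (1 : K)) - f z) =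
     - h^-1 * (f (z + h) - f z - h * df).
    rewrite /= /shift scaler1 addrC [h + z]addrC; change (h^-1 *: (f (z + h) - f z)) with (h^-1 * (f (z + h) - f z)).
    by field.
  rewrite normrM normrN normfV mulrC ler_pdivrMr ?normr_gt0 //.
  rewrite (le_trans (H _ hr)) // expr2 mulrA ler_wpM2r //.
  rewrite (@le_trans _ _ ((c + 1) * `|h|)) ?ler_wpM2r ?lerDl //.
  by rewrite mulrC -ler_pdivlMr ?ltW // ltr_wpDl.
split; first by apply/cvg_ex; exists df.
exact/cvg_lim.
Unshelve. all: by end_near. Qed.

Section Picard.
Variable R : realType.
Local Notation C := R[i].
Variables (n : nat) (F : 'I_n -> mpoly n C) (p : 'I_n -> C).

(** Picard iteration stays within polynomials since F is polynomial. *)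
Fixpoint picard (k : nat) : 'I_n -> {poly C} :=
  if k is k'.+1 then fun i => (p i)%:P + integ (psubst (picard k') (F i))
  else fun i => (p i)%:P.

Lemma picard_at0 k i : (picard k i).[0] = p i.
Proof.
case: k => [|k] /=; first by rewrite hornerC.
by rewrite hornerD hornerC horner_coef0 coef_integ0 addr0.
Qed.

Lemma picard_deriv k i z :
  (picard k.+1 i)^`().[z] = meval (fun j => (picard k j).[z]) (F i).
Proof. by rewrite /= derivD derivC add0r deriv_integ horner_psubst. Qed.

(* On the disc of radius 1 / (2 L), with L a Lipschitz constant of F for the bound
   M, the iterates stay within distance 1/2 of p and their steps are halved. *)
Let M : C := 1 + \sum_i `|p i|.

Lemma norm_init_le i : `|p i| + 1 <= M.
Proof.
by rewrite /M addrC lerD2l (bigD1 i) //= lerDl sumr_ge0.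
Qed.

Lemma M_ge0 : 0 <= M.
Proof. by rewrite addr_ge0 // sumr_ge0. Qed.

Section Radius.
Variables (L : C).
Hypotheses (L0 : 0 < L) (lip : forall i, lipschitz_const M (F i) L).
Let rho : C := (2 * L)^-1.

Lemma rho_gt0 : 0 < rho.
Proof. by rewrite invr_gt0 mulr_gt0. Qed.
Let rho0 : 0 <= rho := ltW rho_gt0.

Lemma rhoL : rho * L = 2^-1.
Proof. by rewrite /rho invfM mulfVK ?gt_eqF. Qed.

Lemma picard_bound k i : pnorm rho (picard k i) <= M.
Proof.
elim: k i => [|k IH] i /=.
  by rewrite pnormC (le_trans _ (norm_init_le i)) // lerDl.
have [|h _] := lip i rho0 (lexx 0) IH IH.
  by move=> j; rewrite subrr -polyC0 pnormC normr0.
rewrite (le_trans (pnormD rho0 _ _)) // (le_trans _ (norm_init_le i)) //.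
rewrite pnormC lerD2l (le_trans (pnorm_integ rho0 _)) //.
rewrite (@le_trans _ _ (rho * L)) ?ler_wpM2l // rhoL invf_le1 ?ler1n //.
Qed.

Lemma picard_step k i : pnorm rho (picard k.+1 i - picard k i) <= (2 ^+ k)^-1.
Proof.
elim: k i => [|k IH] i.
  rewrite /= addrAC subrr add0r (le_trans (pnorm_integ rho0 _)) //.
  have [|h _] := lip i rho0 (lexx 0) (picard_bound 0) (picard_bound 0).
    by move=> j; rewrite subrr -polyC0 pnormC normr0.
  rewrite (@le_trans _ _ (rho * L)) ?ler_wpM2l // rhoL expr0 invr1 invf_le1 ?ler1n //.
have -> : picard k.+2 i - picard k.+1 i =
    integ (psubst (picard k.+1) (F i) - psubst (picard k) (F i)).
  by rewrite integB /=; ring.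
have e0 : 0 <= (2 ^+ k)^-1 :> C by rewrite invr_ge0 exprn_ge0.
have [_ h] := lip i rho0 e0 (picard_bound k.+1) (picard_bound k) IH.
rewrite (le_trans (pnorm_integ rho0 _)) // exprS invfM -rhoL -mulrA.
by rewrite ler_wpM2l.
Qed.

Lemma picard_limit : exists u : C -> 'I_n -> C, forall z i k,
  `|z| <= rho -> `|(picard k i).[z] - u z i| <= 4 / 2 ^+ k.
Proof.
have ex (zi : C * 'I_n) : exists l : C, `|zi.1| <= rho ->
    forall k, `|(picard k zi.2).[zi.1] - l| <= 4 / 2 ^+ k.
  case: zi => z i /=; have [zr|nzr] := pselect (`|z| <= rho); last by exists 0.
  have [k|l Hl] := @geometric_limit R (fun k => (picard k i).[z]).
    rewrite -hornerN -hornerD (le_trans (horner_le_pnorm rho0 _ zr)) //.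
    exact: picard_step.
  by exists l.
have [u Hu] := choice ex.
by exists (fun z i => u (z, i)) => z i k zr; apply: Hu.
Qed.

End Radius.

(** The iterates satisfy the quadratic Taylor estimate with a uniform constant, and
    the derivative of the next iterate is F of the present one; so the estimate
    passes to the pointwise limit, with F(u(z)) in place of the derivative. *)
Lemma picard_solution : exists (r c : C) (u : C -> 'I_n -> C),
  [/\ 0 < r, 0 <= c, forall i, u 0 i = p i
    & forall z h i, `|z| < r -> `|z + h| < r ->
      `|u (z + h) i - u z i - h * meval (u z) (F i)| <= c * `|h| ^+ 2].
Proof.
have [L L0 lip] := psubst_lipschitz_family F M_ge0.
have M4 : 0 <= M + 4 by rewrite addr_ge0 ?M_ge0.
have [L' L'0 lip'] := psubst_lipschitz_family F M4.
have [u Hu] := picard_limit L0 lip.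
have r0 := rho_gt0 L0; set rho := (2 * L)^-1 in r0 Hu *.
have r20 : 0 < rho / 2 by rewrite divr_gt0.
have half (z : C) : `|z| < rho / 2 -> `|z| <= rho.
  by move=> /ltW h; rewrite (le_trans h) // ler_pdivrMr // ler_peMr ?ltW // ltr1n.
exists (rho / 2), (M / (rho / 2) ^+ 2), u; split=> //.
- by rewrite divr_ge0 ?M_ge0 // exprn_ge0 // ltW.
- move=> i; apply/eqP; rewrite -subr_eq0 -normr_le0.
  apply: (@le_geometric R _ _ 4) => // k; rewrite add0r distrC -(picard_at0 k).
  by apply: Hu; rewrite normr0 ltW.
move=> z h i zr zhr.
have zr' := half _ zr; have zhr' := half _ zhr.
rewrite mulrAC ler_pdivlMr ?exprn_gt0 //.
pose c : C := (4 + `|h| * (L' * 4)) * (rho / 2) ^+ 2.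
have r20' := exprn_ge0 2 (ltW r20).
have c0 : 0 <= c by rewrite mulr_ge0 // addr_ge0 // mulr_ge0 // mulr_ge0 // ltW.
apply: (@le_geometric R _ _ c) => //; first by rewrite mulr_ge0.
  by rewrite mulr_ge0 ?exprn_ge0 ?M_ge0.
move=> k; set e : C := 4 / 2 ^+ k.
have e0 : 0 <= e by rewrite divr_ge0 // exprn_ge0.
have eS : 4 / 2 ^+ k.+1 = e / 2 by rewrite /e exprS invfM; ring.
set x := (picard k.+1 i).[z + h]; set y := (picard k.+1 i).[z].
set d := meval (fun j => (picard k j).[z]) (F i).
have Hx : `|x - u (z + h) i| <= e / 2 by rewrite -eS; apply: Hu.
have Hy : `|y - u z i| <= e / 2 by rewrite -eS; apply: Hu.
have bnd j : `|(picard k j).[z]| <= M.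
  by rewrite (le_trans (horner_le_pnorm (ltW r0) _ zr')) // picard_bound.
have Hd : `|d - meval (u z) (F i)| <= L' * e.
  apply: (meval_lipschitz (lip' i)) => // j; last exact: Hu.
    by rewrite (le_trans (bnd j)) // lerDl.
  (* The limit is within distance 4 of the initial iterate, hence the bound M + 4. *)
  have := Hu z j 0%N zr'; rewrite expr0 divr1 distrC => h4.
  rewrite -(subrK (picard 0 j).[z] (u z j)) addrC (le_trans (ler_normD _ _)) //.
  rewrite lerD // (le_trans (horner_le_pnorm (ltW r0) _ zr')) //.
  exact: picard_bound.
have Ht : `|x - y - h * d| * (rho / 2) ^+ 2 <= M * `|h| ^+ 2.
  have := taylor_bound (ltW r0) (picard k.+1 i) (ltW zr) (ltW zhr).
  rewrite picard_deriv -/x -/y -/d mulrC => /le_trans; apply.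
  by rewrite mulrC ler_wpM2r ?exprn_ge0 // picard_bound.
have -> : u (z + h) i - u z i - h * meval (u z) (F i) =
  (x - y - h * d) + (- (x - u (z + h) i) + ((y - u z i) + h * (d - meval (u z) (F i)))).
  by ring.
have -> : M * `|h| ^+ 2 + c / 2 ^+ k =
  M * `|h| ^+ 2 + (e / 2 + (e / 2 + `|h| * (L' * e))) * (rho / 2) ^+ 2.
  by rewrite /c /e; field; rewrite expf_neq0 // pnatr_eq0.
apply: (@le_trans _ _ ((`|x - y - h * d| + (e / 2 + (e / 2 + `|h| * (L' * e)))) * (rho / 2) ^+ 2)).
  rewrite ler_wpM2r //.
  rewrite (le_trans (ler_normD _ _)) // lerD2l (le_trans (ler_normD _ _)) // normrN lerD //.
  rewrite (le_trans (ler_normD _ _)) // lerD // normrM ler_wpM2l //.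
by rewrite mulrDl lerD2r.
Qed.

End Picard.

(** The complex numbers with the structure of an algebraically closed field, from
    which their topology is inferred. *)
Notation CC R := (complex_complex__canonical__Num_ClosedField R).

(** The solution is Lipschitz at 0, so Q does not vanish along it on a small
    disc. *)
Theorem local_flow (R : realType) (n : nat) (F : 'I_n -> mpoly n (CC R))
    (Q : mpoly n (CC R)) (p : 'I_n -> CC R) : meval p Q != 0 ->
  exists (r : CC R) (u : CC R -> 'I_n -> CC R), [/\ 0 < r, forall i, u 0 i = p i
    & forall z : CC R, `|z| < r -> meval (u z) Q != 0 /\
      forall i, is_derive z 1 (fun w => u w i) (meval (u z) (F i))].
Proof.
move=> Qp; have [r [c [u [r0 c0 u0 H]]]] := picard_solution F p.
have u0E P : meval (u 0) P = meval p P by apply: meval_eq.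
pose K := \sum_i `|meval p (F i)| + c * r.
have K0 : 0 <= K by rewrite addr_ge0 ?mulr_ge0 ?sumr_ge0 // ltW.
have HK z i : `|z| < r -> `|u z i - p i| <= K * `|z|.
  move=> zr; have := H 0 z i; rewrite normr0 add0r u0 u0E => /(_ r0 zr) h.
  rewrite -(subrK (z * meval p (F i)) (u z i - p i)) (le_trans (ler_normD _ _)) //.
  rewrite /K mulrDl addrC lerD //.
    rewrite normrM mulrC ler_wpM2r // (bigD1 i) //= lerDl sumr_ge0 //.
  by rewrite (le_trans h) // expr2 mulrA ler_wpM2r // ler_wpM2l // ltW.
pose M := \sum_i `|p i| + K * r.
have pM i : `|p i| <= \sum_i `|p i| by rewrite (bigD1 i) //= lerDl sumr_ge0.
have M0 : 0 <= M by rewrite addr_ge0 ?mulr_ge0 ?sumr_ge0 // ltW.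
have [L L0 lip] := psubst_lipschitz Q M0.
have QL z : `|z| < r -> `|meval (u z) Q - meval p Q| <= L * (K * `|z|).
  move=> zr; apply: (meval_lipschitz lip).
  - by rewrite mulr_ge0.
  - move=> i; rewrite -(subrK (p i) (u z i)) addrC (le_trans (ler_normD _ _)) // lerD //.
    by rewrite (le_trans (HK _ _ zr)) // ler_wpM2l // ltW.
  - by move=> i; rewrite (le_trans (pM i)) // lerDl mulr_ge0 // ltW.
  - by move=> i; apply: HK.
pose s := `|meval p Q| / (L * K + 1).
have s0 : 0 < s by rewrite divr_gt0 ?normr_gt0 // ltr_wpDl // mulr_ge0.
(* A radius smaller than both r and s. *)
pose d := (r^-1 + s^-1)^-1.
have ri0 : 0 < r^-1 by rewrite invr_gt0.
have si0 : 0 < s^-1 by rewrite invr_gt0.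
have d0 : 0 < d by rewrite invr_gt0 addr_gt0.
have dr : d < r by rewrite /d -[ltRHS]invrK ltf_pV2 ?posrE ?addr_gt0 // ltrDl.
have ds : d < s by rewrite /d -[ltRHS]invrK ltf_pV2 ?posrE ?addr_gt0 // ltrDr.
exists d, u; split=> // z zd; have zr := lt_trans zd dr; split.
  apply/eqP => Qz; have := QL z zr; rewrite Qz sub0r normrN mulrA => h.
  have : `|z| < s := lt_trans zd ds.
  rewrite /s ltr_pdivlMr; last by rewrite ltr_wpDl // mulr_ge0.
  have h1 : L * K * `|z| <= `|z| * (L * K + 1) by rewrite [leRHS]mulrDr mulr1 [leLHS]mulrC lerDl.
  by move=> /(le_lt_trans (le_trans h h1)); rewrite ltxx.
move=> i; apply: (@is_derive_quadratic _ _ _ _ (r - `|z|) c) => //.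
  by rewrite subr_gt0.
move=> h hr; apply: H => //.
by rewrite (le_lt_trans (ler_normD _ _)) // addrC -ltrBrDr.
Qed.

(** * Discs *)
Section Disc.
Variable R : realType.
Local Notation C := (CC R).

Lemma disc_open (r : C) : open [set z : C | `|z| < r].
Proof.
rewrite openE => z /= zr; apply/nbhs_ballP; exists (r - `|z|); first by rewrite /= subr_gt0.
move=> w; rewrite /ball /= => h.
rewrite -(subrK z w) (le_lt_trans (ler_normD _ _)) // -ltrBrDr distrC //.
Qed.

(** The disc is a union of segments starting at 0. *)
Lemma disc_connected (r : C) : 0 < r -> connected [set z : C | `|z| < r].
Proof.
move=> r0; pose seg (z : C) := (fun t : R => t%:C%C * z) @` [set` `[0, 1]].
have -> : [set z : C | `|z| < r] = \bigcup_(z in [set z : C | `|z| < r]) seg z.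
  apply/seteqP; split=> [z zr|z [w /= wr [t]]].
    by exists z => //; exists 1; rewrite ?mul1r //= in_itv /= ler01 lexx.
  rewrite /= in_itv /= => /andP[t0 t1] <-; rewrite normrM (le_lt_trans _ wr) //.
  rewrite ler_piMl // normc_def /= expr0n addr0 sqrtr_sqr ger0_norm //.
  by rewrite lecR.
apply: bigcup_connected.
  exists 0 => z _; exists 0; rewrite ?mul0r //= in_itv /= lexx ler01 //.
move=> z _; apply: connected_continuous_connected; first exact: segment_connected.
apply: continuous_subspaceT => t; apply/cvgrPdist_lt => e e0.
have z1 : 0 < `|z| + 1 by rewrite ltr_wpDl.
have := divr_gt0 e0 z1; case E : (e / (`|z| + 1)) => [dr di].
rewrite ltcE /= => /andP[/eqP di0 dr0].
near=> x.
have tx : `|t - x| < dr by near: x; by apply/nbhs_ballP; exists dr.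
rewrite -mulrBl -rmorphB normrM.
have -> : `|(t - x)%:C%C| = `|t - x|%:C%C :> C.
  by rewrite normc_def /= expr0n addr0 sqrtr_sqr.
rewrite (@le_lt_trans _ _ (`|t - x|%:C%C * (`|z| + 1))) //.
  by rewrite ler_wpM2l ?lerDl // lecR.
by rewrite -ltr_pdivlMr // E ltcE /= di0 eqxx.
Unshelve. all: by end_near. Qed.

End Disc.

(** * Polynomials along a curve *)
Section Calculus.
Variable K : numFieldType.
Implicit Types (f g : K -> K).

Lemma is_derive_add f g (z df dg : K) : is_derive z 1 f df -> is_derive z 1 g dg ->
  is_derive z 1 (fun w => f w + g w) (df + dg).
Proof. by move=> hf hg; apply: is_deriveD. Qed.

Lemma is_derive_mul f g (z df dg : K) : is_derive z 1 f df -> is_derive z 1 g dg ->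
  is_derive z 1 (fun w => f w * g w) (df * g z + f z * dg).
Proof.
move=> hf hg; apply: (is_derive_eq (is_deriveM hf hg)).
by rewrite addrC mulrC.
Qed.

Lemma is_derive_const (c z : K) : is_derive z 1 (fun=> c) 0.
Proof. exact: is_derive_cst. Qed.

Lemma is_derive_inv f (z df : K) : f z != 0 -> is_derive z 1 f df ->
  is_derive z 1 (fun w => (f w)^-1) (- df / f z ^+ 2).
Proof.
move=> fz hf; have df1 : derivable f z 1 by [].
apply: DeriveDef; first exact: derivableV.
rewrite deriveV // derive_val -[LHS]/(- (f z) ^- 2 * df).
by rewrite mulNr mulrC mulNr.
Qed.

(** The chain rule, one variable at a time: if the curve moves along d with speed g
    in the coordinates of A, and its new coordinate u has the derivative g F, then
    it moves along [poly_der d F] with speed g. *)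
Lemma is_derive_eval_ext (A : idomainType) (d : A -> A) (derd : derivation d)
    (ev : K -> {rmorphism A -> K}) (u : K -> K) (F : {poly A}) (z g : K) :
  (forall x, is_derive z 1 (fun w => ev w x) (g * ev z (d x))) ->
  is_derive z 1 u (g * eval_ext (ev z) (u z) F) ->
  forall P, is_derive z 1 (fun w => eval_ext (ev w) (u w) P)
                          (g * eval_ext (ev z) (u z) (poly_der d F P)).
Proof.
move=> hev hu; have derF := poly_derP derd F.
elim/poly_ind => [|P c IH].
  rewrite (der0 derF) rmorph0 mulr0.
  rewrite (_ : (fun w => _) = (fun=> 0)); first exact: is_derive_const.
  by apply/funext => w; rewrite rmorph0.
have -> : (fun w => eval_ext (ev w) (u w) (P * 'X + c%:P)) =
    (fun w => eval_ext (ev w) (u w) P * u w + ev w c).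
  by apply/funext => w; rewrite rmorphD rmorphM eval_extX eval_extC.
have h := is_derive_add (is_derive_mul IH hu) (hev c).
apply: (is_derive_eq h).
rewrite (derD derF) (derM derF) poly_derX // poly_derC //.
by move: (poly_der d F P) => P'; rewrite 2!rmorphD 2!rmorphM eval_extX eval_extC; ring.
Qed.

Lemma is_derive_locally0 f (z df : K) (D : set K) : open D -> D z ->
  (forall w, D w -> f w = 0) -> is_derive z 1 f df -> df = 0.
Proof.
move=> oD Dz f0 hf.
have : is_derive z 1 (fun=> 0 : K) df.
  apply: near_eq_is_derive hf; near=> w; apply: f0; near: w.
  exact: open_nbhs_nbhs.
by case=> _ <-; rewrite derive_cst.
Unshelve. all: by end_near. Qed.

(** On the line p + s e, the product of h and the restriction of P vanishes
    everywhere. *)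
Lemma meval_line0 n (P : mpoly n K) (p e : 'I_n -> K) (h : {poly K}) : h != 0 ->
  (forall s, h.[s] != 0 -> meval (fun i => p i + s * e i) P = 0) -> meval p P = 0.
Proof.
move=> h0 H; pose f := psubst (fun i => (p i)%:P + e i *: 'X) P.
have fE s : f.[s] = meval (fun i => p i + s * e i) P.
  rewrite horner_psubst; apply: meval_eq => i.
  by rewrite hornerD hornerC hornerZ hornerX mulrC.
have /eqP : f * h = 0.
  apply/eqP; apply: contraT => fh0.
  pose rs := [seq i%:R : K | i <- iota 0 (size (f * h)%R)].
  have := @max_poly_roots _ _ rs fh0; rewrite size_map size_iota ltnn => -> //.
    apply/allP => _ /mapP[i _ ->]; apply/rootP; rewrite hornerM.
    have [->|hi] := eqVneq h.[i%:R] 0; first by rewrite mulr0.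
    by rewrite fE H // mul0r.
  rewrite map_inj_uniq ?iota_uniq // => i j /eqP; by rewrite eqr_nat => /eqP.
rewrite mulf_eq0 (negPf h0) orbF => /eqP f0.
transitivity f.[0]; last by rewrite f0 horner0.
by rewrite fE; apply: meval_eq => i; rewrite mul0r addr0.
Qed.

End Calculus.

(** * The polynomial vector field *)

(** The components q, q y', q y'', q A of the field, after the denominators of A have
    been cancelled against q. The numbers 1/2, 1728, 1968, 2654208 and 3 are
    variables, so that the formula can be used in any ring and no proof has to
    compute with the unary numerals. *)
Definition j_velocity (S : comNzRingType) (half a b c three y y1 y2 : S) : seq S :=
  let q := y ^+ 3 * (y - a) ^+ 3 * y1 ^+ 2 in
  [:: q; q * y1; q * y2;
      half * (three * y2 ^+ 2 * y1 * y ^+ 3 * (y - a) ^+ 3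
        - (y ^+ 2 - b * y + c) * y * (y - a) * y1 ^+ 5)].

Lemma rmorph_j_velocity (S T : comNzRingType) (f : {rmorphism S -> T}) h a b c d y y1 y2 i :
  f (j_velocity h a b c d y y1 y2)`_i =
  (j_velocity (f h) (f a) (f b) (f c) (f d) (f y) (f y1) (f y2))`_i.
Proof.
case: i => [|[|[|[|i]]]] /=; last by rewrite !nth_nil rmorph0.
all: by rewrite !(rmorphM, rmorphD, rmorphB, rmorphN, rmorphXn).
Qed.

(** The indices of the coordinates are variables as well, because the same
    polynomials are also needed on C^4 x C^4. *)
Definition j_component (F : comNzRingType) n (h a b c d : F) (i1 i2 i3 : 'I_n) (k : nat) : mpoly n F :=
  (j_velocity (mpolyC n h) (mpolyC n a) (mpolyC n b) (mpolyC n c) (mpolyC n d)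
     (mpolyX F (mnm1 i1)) (mpolyX F (mnm1 i2)) (mpolyX F (mnm1 i3)))`_k.

Definition j_polynomial_field (F : fieldType) (i : 'I_4) : mpoly 4 F :=
  j_component 2^-1 1728 1968 (1536 * 1728) 3 (inord 1) (inord 2) (inord 3) i.

(** The only arithmetic relations between the coefficients of R that are used. *)
Lemma j_constants (K : numFieldType) :
  (1968 : K) = 41 * 1728 / 36 /\ (1536 : K) = 8 * 1728 / 9.
Proof.
have -> : (1728 : K) = 36%:R * 48%:R by rewrite -natrM.
have -> : (1968 : K) = 41%:R * 48%:R by rewrite -natrM.
have -> : (1536 : K) = 32%:R * 48%:R by rewrite -natrM.
by split; field.
Qed.

Definition vec4 (K : nmodType) (t y y1 y2 : K) : 'I_4 -> K := fun i => [:: t; y; y1; y2]`_i.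

Lemma meval_j_component (F : comNzRingType) n (v : 'I_n -> F) h a b c d i1 i2 i3 k :
  meval v (j_component h a b c d i1 i2 i3 k) = (j_velocity h a b c d (v i1) (v i2) (v i3))`_k.
Proof. by rewrite [LHS]rmorph_j_velocity /= !mevalC !mevalXU. Qed.

Lemma meval_j_polynomial_field (K : numClosedFieldType) (v : 'I_4 -> K) i :
  meval v (j_polynomial_field K i) = (j_velocity 2^-1 1728 (41 * 1728 / 36) (8 * 1728 / 9 * 1728) 3
    (v (inord 1)) (v (inord 2)) (v (inord 3)))`_i.
Proof. by rewrite meval_j_component -(j_constants K).1 -(j_constants K).2. Qed.

(** * The change of coordinates *)
Section Transfer.
Variables (K : numClosedFieldType) (a : K).

Lemma ev_tE (y U s t : K) :
  [/\ ev_t y U s t 'X = t, ev_t y U s t 'X%:P = s,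
      ev_t y U s t 'X%:P%:P = U, ev_t y U s t 'X%:P%:P%:P = y
    & forall c, ev_t y U s t c%:P%:P%:P%:P = c].
Proof. by split=> *; rewrite /ev_t /ev_s /ev_U /ev_y ?eval_extC ?eval_extX. Qed.

Lemma ev_y_vel_y (y : K) : ev_y y (vel_y a) = y * (y - a).
Proof.
rewrite /ev_y /vel_y rmorphM rmorphB; congr (_ * (_ - _)); exact: eval_extX || exact: eval_extC.
Qed.

Lemma ev_U_vel_U (y U : K) : ev_U y U (vel_U a) =
  - (U * U) + (y - a) * U + (41 * a / 144 * y - 2 * a ^+ 2 / 9).
Proof.
rewrite /ev_U /vel_U rmorphD [X in X + _]rmorphD rmorphN !rmorphM !eval_extC eval_extX.
congr (- _ + _ * _ + _).
  by rewrite rmorphB; congr (_ - _); [exact: eval_extX | exact: eval_extC].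
rewrite /vel_U0 -mul_polyC rmorphB rmorphM; congr (_ * _ - _).
- exact: eval_extC.
- exact: eval_extX.
- exact: eval_extC.
Qed.

Lemma ev_s_vel_s (y U s : K) : ev_s y U s (vel_s a) = (y - a - 2 * U) * s.
Proof.
rewrite /ev_s /vel_s rmorphM eval_extC eval_extX; congr (_ * _).
rewrite /tau rmorphB rmorphMn -mulr_natl; congr (_ - _ * _); last exact: eval_extX.
rewrite [LHS]eval_extC rmorphB; congr (_ - _); [exact: eval_extX | exact: eval_extC].
Qed.

Lemma ev_t_vel_t (y U s t : K) : ev_t y U s t (vel_t K) = s.
Proof. by rewrite /ev_t /vel_t eval_extC; exact: eval_extX. Qed.

(** In the new coordinates y' = y (y - a) / s and y'' = y (y - a) (2 U + y) / s^2, so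
    a power of s clears the denominators of P. *)
Lemma pullback_tower (P : mpoly 4 K) :
  exists (N : nat) (Q : {poly {poly {poly {poly K}}}}), forall y U s t, s != 0 ->
  ev_t y U s t Q = s ^+ N *
    meval (vec4 t y (y * (y - a) / s) (y * (y - a) * (2 * U + y) / s ^+ 2)) P.
Proof.
pose b : {poly {poly {poly {poly K}}}} := (vel_y a)%:P%:P%:P.
have bE y U s t : ev_t y U s t b = y * (y - a) by rewrite /ev_t !eval_extC ev_y_vel_y.
elim/mpoly_ring_ind: P => [c|i|P1 P2 [N1 [Q1 H1]] [N2 [Q2 H2]]|P1 P2 [N1 [Q1 H1]] [N2 [Q2 H2]]].
- exists 0%N, c%:P%:P%:P%:P => y U s t _; have [_ _ _ _ E] := ev_tE y U s t.
  by rewrite mevalC mul1r; exact: E.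
- case: i => [[|[|[|[|//]]]] lt].
  + exists 0%N, 'X => y U s t _; have [E _ _ _ _] := ev_tE y U s t.
    by rewrite mevalXU mul1r; exact: E.
  + exists 0%N, 'X%:P%:P%:P => y U s t _; have [_ _ _ E _] := ev_tE y U s t.
    by rewrite mevalXU mul1r; exact: E.
  + exists 1%N, b => y U s t s0; rewrite bE mevalXU /vec4 /=.
    by field.
  + exists 2%N, (b * ('X%:P%:P *+ 2 + 'X%:P%:P%:P)) => y U s t s0.
    have [_ _ EU Ey _] := ev_tE y U s t.
    rewrite rmorphM bE rmorphD rmorphMn EU Ey mevalXU /vec4 /= -mulr_natl.
    by field.
- exists (N1 + N2)%N, ('X%:P ^+ N2 * Q1 + 'X%:P ^+ N1 * Q2) => y U s t s0.
  have [_ Es _ _ _] := ev_tE y U s t.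
  rewrite rmorphD 2!rmorphM 2!rmorphXn Es H1 // H2 // mevalD exprD; ring.
- exists (N1 + N2)%N, (Q1 * Q2) => y U s t s0.
  by rewrite rmorphM H1 // H2 // mevalM exprD; ring.
Qed.

Lemma vec4_coord (v : 'I_4 -> K) : v =1 vec4 (v (inord 0)) (v (inord 1)) (v (inord 2)) (v (inord 3)).
Proof.
by move=> i; case: i => [[|[|[|[|//]]]] lt]; rewrite /vec4 /=; congr v; apply/val_inj; rewrite /= inordK.
Qed.

Lemma chart_vec4 (t y y1 y2 : K) : y * (y - a) != 0 -> y1 != 0 ->
  let s := y * (y - a) / y1 in let U := y * (y - a) * y2 / (2 * y1 ^+ 2) - y / 2 in
  vec4 t y (y * (y - a) / s) (y * (y - a) * (2 * U + y) / s ^+ 2) = vec4 t y y1 y2.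
Proof.
rewrite mulf_eq0 negb_or => /andP[y0 ya0] y10 s U; rewrite /s /U.
congr vec4; field; rewrite ?y0 ?ya0 ?y10 //.
Qed.

Section Curve.
Variables (D : set K) (u : K -> 'I_4 -> K).
Hypothesis oD : open D.
Let t w := u w (inord 0).
Let y w := u w (inord 1).
Let y1 w := u w (inord 2).
Let y2 w := u w (inord 3).
Hypothesis y_neq0 : forall z, D z -> y z * (y z - a) != 0.
Hypothesis y1_neq0 : forall z, D z -> y1 z != 0.
Hypothesis du : forall z, D z -> forall i : 'I_4, is_derive z 1 (fun w => u w i)
  (j_velocity 2^-1 a (41 * a / 36) (8 * a / 9 * a) 3 (y z) (y1 z) (y2 z))`_i.

Let s w := y w * (y w - a) / y1 w.
Let U w := y w * (y w - a) * y2 w / (2 * y1 w ^+ 2) - y w / 2.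
(* The field is g times the derivation D of the tower. *)
Let g w := (y w * (y w - a)) ^+ 2 * y1 w ^+ 3.

Lemma derive_coord k (z : K) : D z -> (k < 4)%N -> is_derive z 1 (fun w => u w (inord k))
  (j_velocity 2^-1 a (41 * a / 36) (8 * a / 9 * a) 3 (y z) (y1 z) (y2 z))`_k.
Proof. by move=> Dz k4; have := du Dz (inord k); rewrite inordK. Qed.

Lemma is_derive_y (z : K) : D z -> is_derive z 1 y (g z * (y z * (y z - a))).
Proof.
by move=> Dz; apply: (is_derive_eq (derive_coord Dz (isT : (1 < 4)%N))); rewrite /= /g; ring.
Qed.

Lemma is_derive_t (z : K) : D z -> is_derive z 1 t (g z * s z).
Proof.
move=> Dz; apply: (is_derive_eq (derive_coord Dz (isT : (0 < 4)%N))).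
by have := y1_neq0 Dz; rewrite /= /g /s => h; field.
Qed.

Lemma is_derive_b (z : K) : D z -> is_derive z 1 (fun w => y w * (y w - a))
  (g z * (y z * (y z - a)) * (2 * y z - a)).
Proof.
move=> Dz; have dy := is_derive_y Dz.
have h := is_derive_mul dy (is_derive_add dy (is_derive_const (- a) z)).
by apply: (is_derive_eq h); ring.
Qed.

Lemma is_derive_s (z : K) : D z -> is_derive z 1 s (g z * ((y z - a - 2 * U z) * s z)).
Proof.
move=> Dz; have y10 := y1_neq0 Dz.
have dy1 := derive_coord Dz (isT : (2 < 4)%N).
have h := is_derive_mul (is_derive_b Dz) (is_derive_inv y10 dy1).
by apply: (is_derive_eq h); rewrite /= /s /U /g -/(y1 z); field.
Qed.

Lemma is_derive_U (z : K) : D z -> is_derive z 1 U (g z *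
  (- (U z * U z) + (y z - a) * U z + (41 * a / 144 * y z - 2 * a ^+ 2 / 9))).
Proof.
move=> Dz; have y10 := y1_neq0 Dz; have yn := y_neq0 Dz.
have dy1 := derive_coord Dz (isT : (2 < 4)%N).
have dy2 := derive_coord Dz (isT : (3 < 4)%N).
have n1 : 2 * (y1 z * y1 z) != 0 by rewrite !mulf_neq0 // pnatr_eq0.
have h := is_derive_add (is_derive_mul (is_derive_mul (is_derive_b Dz) dy2)
   (@is_derive_inv _ (fun w => 2 * (y1 w * y1 w)) z _ n1 (is_derive_mul (is_derive_const 2 z) (is_derive_mul dy1 dy1))))
  (is_derive_mul (is_derive_y Dz) (is_derive_const (- 2^-1) z)).
have -> : U = fun w => y w * (y w - a) * y2 w * (2 * (y1 w * y1 w))^-1 + y w * - 2^-1.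
  by apply/funext => w; rewrite /U mulrN expr2.
apply: (is_derive_eq h) => /=.
rewrite /U /g -/(y1 z) -/(y2 z); field.
exact: y10.
Qed.

Let ev w := ev_t (y w) (U w) (s w) (t w).

Lemma is_derive_ev (z : K) : D z ->
  forall Q, is_derive z 1 (fun w => ev w Q) (g z * ev z (der_t a Q)).
Proof.
move=> Dz.
have d0 (c : K) : is_derive z 1 (fun w : K => (idfun : {rmorphism K -> K}) c) (g z * (idfun : {rmorphism K -> K}) 0).
  by rewrite mulr0; exact: is_derive_const.
have dy : is_derive z 1 y (g z * ev_y (y z) (vel_y a)).
  by rewrite ev_y_vel_y; exact: is_derive_y.
have d1 := is_derive_eval_ext (derivation_zero K) d0 dy.
have dU : is_derive z 1 U (g z * ev_U (y z) (U z) (vel_U a)).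
  by rewrite ev_U_vel_U; exact: is_derive_U.
have d2 := is_derive_eval_ext (derivation_y a) d1 dU.
have ds : is_derive z 1 s (g z * ev_s (y z) (U z) (s z) (vel_s a)).
  by rewrite ev_s_vel_s; exact: is_derive_s.
have d3 := is_derive_eval_ext (derivation_U a) d2 ds.
have dt : is_derive z 1 t (g z * ev_t (y z) (U z) (s z) (t z) (vel_t K)).
  by rewrite ev_t_vel_t; exact: is_derive_t.
exact (is_derive_eval_ext (derivation_s a) d3 dt).
Qed.

(** Differentiating along the curve preserves vanishing on the curve, and the speed g
    has no zeros there. *)
Lemma flat_of_vanishing z Q : D z -> (forall w, D w -> ev w Q = 0) ->
  flat (der_t a) (ev z) Q.
Proof.
move=> Dz Q0 k; suff : forall w, D w -> ev w (iter k (der_t a) Q) = 0 by apply.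
elim: k => [|k IH] //= w Dw.
have /eqP := is_derive_locally0 oD Dw IH (is_derive_ev Dw (iter k (der_t a) Q)).
rewrite mulf_eq0 => /orP[|/eqP //].
by rewrite /g mulf_eq0 !expf_eq0 (negPf (y_neq0 Dw)) (negPf (y1_neq0 Dw)).
Qed.

(** The polynomial Q obtained from P in the new coordinates is flat, hence zero.
    Therefore P vanishes wherever the new coordinates are defined, that is, where
    y (y - a) y' is not zero. A generic point of the line through x in direction
    (0, 1, 1, 0) has this property, so P vanishes at x. *)
Theorem curve_dense (P : mpoly 4 K) (z : K) : a != 0 -> D z ->
  (forall w, D w -> meval (u w) P = 0) -> forall x, meval x P = 0.
Proof.
move=> a0 Dz P0 x.
have [N [Q HQ]] := pullback_tower P.
have s_neq0 w : D w -> s w != 0.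
  by move=> Dw; rewrite mulf_neq0 ?invr_eq0 ?y_neq0 ?y1_neq0.
have Q0 : Q = 0.
  apply: (flat_t_trivial a0 _ (s_neq0 _ Dz) (flat_of_vanishing Dz _)).
    by rewrite /vel_y hornerM hornerD hornerN hornerX hornerC (y_neq0 Dz).
  move=> w Dw; rewrite HQ ?s_neq0 // chart_vec4 ?y_neq0 ?y1_neq0 //.
  by rewrite -(meval_eq _ (vec4_coord (u w))) P0 ?mulr0.
pose e := vec4 0 1 1 0 : 'I_4 -> K.
pose X0 := x (inord 1); pose X1 := x (inord 2).
pose h : {poly K} := (X0%:P + 'X) * ((X0 - a)%:P + 'X) * (X1%:P + 'X).
have nz c : c%:P + 'X != 0 :> {poly K}.
  by rewrite -size_poly_eq0 addrC size_XaddC.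
apply: (@meval_line0 _ _ P x e h); first by rewrite !mulf_neq0.
move=> c; rewrite /h !(hornerM, hornerD, hornerC, hornerX) => hc.
pose v i := x i + c * e i.
rewrite -/(v _) (meval_eq _ (vec4_coord v)).
have v1 : v (inord 1) = X0 + c by rewrite /v /e /vec4 inordK // mulr1.
have v2 : v (inord 2) = X1 + c by rewrite /v /e /vec4 inordK // mulr1.
move: hc; rewrite !mulf_eq0 !negb_or -addrA [- a + c]addrC addrA -v1 -v2 => /andP[/andP[h1 h2] h3].
have b_neq0 : v (inord 1) * (v (inord 1) - a) != 0 by rewrite mulf_neq0.
rewrite -(chart_vec4 _ _ b_neq0 h3).
have s1 : v (inord 1) * (v (inord 1) - a) / v (inord 2) != 0.
  by rewrite mulf_neq0 ?invr_eq0.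
apply: (mulfI (expf_neq0 N s1)); rewrite -HQ // Q0 mulr0; exact: rmorph0.
Qed.

End Curve.
End Transfer.

(** * The vector field in the field of rational functions *)
Lemma j_velocity_fieldE (F : fieldType) (a b c y y1 y2 : F) i :
  (2 : F) != 0 -> y != 0 -> y - a != 0 -> y1 != 0 ->
  (j_velocity 2^-1 a b c 3 y y1 y2)`_i = y ^+ 3 * (y - a) ^+ 3 * y1 ^+ 2 *
    [:: 1; y1; y2; - ((y ^+ 2 - b * y + c) / (2 * y ^+ 2 * (y - a) ^+ 2)) * y1 ^+ 3
                   + 3 * y2 ^+ 2 / (2 * y1)]`_i.
Proof.
move=> h2 hy hya hy1; case: i => [|[|[|[|i]]]] //=; last 1 first.
- by rewrite !nth_nil mulr0.
- by rewrite mulr1.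
by field; rewrite h2 hy hya hy1.
Qed.

Lemma j_velocity_quotient (K F : fieldType) (S : comNzRingType)
    (k : {rmorphism K -> S}) (f : {rmorphism S -> F}) (y y1 y2 : S) i :
  (2 : F) != 0 -> f y != 0 -> f y - 1728 != 0 -> f y1 != 0 ->
  f (j_velocity (k 2^-1) (k 1728) (k 1968) (k (1536 * 1728)) (k 3) y y1 y2)`_i =
  j_q (f y) (f y1) * [:: 1; f y1; f y2; j_A (f y) (f y1) (f y2)]`_i.
Proof.
move=> h2 hy hya hy1; rewrite rmorph_j_velocity.
have -> : f (k 2^-1) = 2^-1.
  by rewrite -[f _]/((f \o k) 2^-1) fmorphV rmorph_nat.
have E n : f (k n%:R) = n%:R by rewrite !rmorph_nat.
rewrite (rmorphM k) (rmorphM f) !E.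
by rewrite j_velocity_fieldE.
Qed.

(** A polynomial that is nonzero at some point is nonzero as a fraction. *)
Lemma tofrac_neq0 (C : numClosedFieldType) (v : 'I_4 -> C) (P : mpoly 4 C) :
  meval v P != 0 -> FracField.tofrac P != 0.
Proof. by apply: contraNneq => /eqP; rewrite tofrac_eq0 => /eqP->; rewrite meval0. Qed.

Lemma tofrac_j_polynomial_field (C : numClosedFieldType) i : FracField.tofrac (j_polynomial_field C i) = j_field C i.
Proof.
have nzX k : FracField.tofrac (mpolyX C (mnm1 (inord k : 'I_4))) != 0.
  by apply: (@tofrac_neq0 _ (fun=> 1)); rewrite mevalXU oner_eq0.
have n2 : (2 : {fraction mpoly 4 C}) != 0.
  rewrite -(rmorph_nat (@FracField.tofrac _)).
  by apply: (@tofrac_neq0 _ (fun=> 1)); rewrite rmorph_nat pnatr_eq0.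
have ny : FracField.tofrac (mpolyX C (mnm1 (inord 1 : 'I_4))) - 1728 != 0.
  rewrite -(rmorph_nat (@FracField.tofrac _)) -rmorphB.
  apply: (@tofrac_neq0 _ (fun=> 0)); rewrite mevalB mevalXU rmorph_nat sub0r oppr_eq0.
  by rewrite pnatr_eq0.
rewrite /j_polynomial_field /j_component /j_field.
exact: (@j_velocity_quotient C _ _ (@mpolyC 4 C) (@FracField.tofrac (mpoly 4 C)) _ _ _ i n2 (nzX 1%N) ny (nzX 2%N)).
Qed.

Lemma map_j_component (F F' : comNzRingType) (f : {rmorphism F -> F'}) n h a b c d
    (i1 i2 i3 : 'I_n) k :
  map_mpoly f (j_component h a b c d i1 i2 i3 k) =
  j_component (f h) (f a) (f b) (f c) (f d) i1 i2 i3 k.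
Proof. by rewrite [LHS]rmorph_j_velocity /= !map_mpolyC !map_mpolyX. Qed.

Lemma defined_over_rationals (C : numClosedFieldType) n (P : mpoly n rat) :
  defined_over (rationals C) (map_mpoly (ratr : rat -> C) P).
Proof. by move=> m; exists (mcoeff m P) => //; rewrite mcoeff_map_mpoly. Qed.

Lemma rationals_algebraic (C : numClosedFieldType) : rationals C `<=` algebraic_numbers C.
Proof.
move=> _ [q _ <-]; exists ('X - q%:P); first by rewrite polyXsubC_eq0.
by rewrite map_polyXsubC root_XsubC.
Qed.

Lemma j_component_rational (C : numClosedFieldType) n (i1 i2 i3 : 'I_n) k :
  defined_over (rationals C) (j_component 2^-1 1728 1968 (1536 * 1728) 3 i1 i2 i3 k).
Proof.
have rat_nat m : rationals C m%:R by exists m%:R => //; rewrite rmorph_nat.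
have rat_inv x : rationals C x -> rationals C x^-1.
  by move=> [q _ <-]; exists q^-1 => //; rewrite fmorphV.
have rat_mul x y : rationals C x -> rationals C y -> rationals C (x * y).
  by move=> [q _ <-] [r _ <-]; exists (q * r) => //; rewrite rmorphM.
have rat_component h a b c d : rationals C h -> rationals C a -> rationals C b ->
    rationals C c -> rationals C d -> defined_over (rationals C) (j_component h a b c d i1 i2 i3 k).
  move=> [h' _ <-] [a' _ <-] [b' _ <-] [c' _ <-] [d' _ <-].
  by rewrite -map_j_component; exact: defined_over_rationals.
by apply: rat_component; [apply: rat_inv | | | apply: rat_mul |]; exact: rat_nat.
Qed.

Lemma subX_rational (C : numClosedFieldType) n (i j : 'I_n) :
  defined_over (rationals C) (mpolyX C (mnm1 i) - mpolyX C (mnm1 j)).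
Proof.
have -> : mpolyX C (mnm1 i) - mpolyX C (mnm1 j) =
    map_mpoly (ratr : rat -> C) (mpolyX rat (mnm1 i) - mpolyX rat (mnm1 j)).
  by rewrite rmorphB /= !map_mpolyX.
exact: defined_over_rationals.
Qed.

Lemma j_velocity_eq0 (F : idomainType) (h a b c d y y1 y2 : F) k :
  y ^+ 3 * (y - a) ^+ 3 * y1 ^+ 2 = 0 -> (j_velocity h a b c d y y1 y2)`_k = 0.
Proof.
move=> q0; case: k => [|[|[|[|k]]]] //=; rewrite ?q0 ?mul0r ?nth_nil //.
move/eqP: q0; rewrite 2!mulf_eq0 !expf_eq0 /= -orbA => /or3P[] /eqP ->; ring.
Qed.

(** The component q already vanishes at the singular points only: if y, y - a or y'
    is zero, so are the other components. *)
Lemma Sing_j_polynomial_field (C : numClosedFieldType) (p : 'rV[C]_4) :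
  Sing (@j_polynomial_field C) p <-> peval (j_polynomial_field C ord0) p = 0.
Proof.
split=> [|h i]; first by apply.
move: h; rewrite /peval !meval_j_polynomial_field; exact: j_velocity_eq0.
Qed.

(** * Orbits and their closures *)

(** A polynomial that vanishes on the orbit vanishes on the local solution through
    p, hence everywhere by [curve_dense]. *)
Lemma nonsingular_orbit_dense (R : realType) (p : 'rV[CC R]_4) :
  ~ Sing (@j_polynomial_field (CC R)) p -> zariski_closure (Defs.orbit (@j_polynomial_field (CC R)) p) = setT.
Proof.
move=> nS; apply/seteqP; split=> // x _ P P0.
have q0 : meval (p 0) (j_polynomial_field (CC R) ord0) != 0 by apply/eqP => /Sing_j_polynomial_field.
have [r [u [r0 u0 H]]] := local_flow (j_polynomial_field (CC R)) q0.
pose D := [set z : CC R | `|z| < r].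
have D0 : D 0 by rewrite /D /= normr0.
pose phi z : 'rV[CC R]_4 := \row_i u z i.
have phiE z : (phi z) 0 = u z by apply/funext => i; rewrite mxE.
have phi0 : phi 0 = p by apply/rowP => i; rewrite mxE u0.
have curve : integral_curve (@j_polynomial_field (CC R)) D phi.
  move=> z Dz; have [qz dz] := H z Dz; split.
    by move/Sing_j_polynomial_field; rewrite /peval phiE => h; rewrite h eqxx in qz.
  move=> i; rewrite /peval phiE.
  rewrite (_ : (fun w => _) = (fun w => u w i)); first exact: dz.
  by apply/funext => w; rewrite phiE.
have on_curve z : D z -> Defs.orbit (@j_polynomial_field (CC R)) p (phi z).
  move=> Dz; right; split=> //; apply: Stdlib.Relations.Relation_Operators.rt_step.
  exists D, phi; split=> //; [exact: disc_open | exact: disc_connected |].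
  by split; [exists 0 | exists z].
have nz z : D z -> u z (inord 1) ^+ 3 * (u z (inord 1) - 1728) ^+ 3 * u z (inord 2) ^+ 2 != 0.
  by move=> Dz; have [qz _] := H z Dz; rewrite meval_j_polynomial_field in qz.
have y_neq0 z : D z -> u z (inord 1) * (u z (inord 1) - 1728) != 0.
  by move/nz; rewrite 2!mulf_eq0 !expf_eq0 /= => /norP[/norP[h1 h2] _]; rewrite mulf_neq0.
have y1_neq0 z : D z -> u z (inord 2) != 0.
  by move/nz; rewrite 2!mulf_eq0 !expf_eq0 /= => /norP[_].
have du z : D z -> forall i, is_derive z 1 (fun w => u w i)
    (j_velocity 2^-1 1728 (41 * 1728 / 36) (8 * 1728 / 9 * 1728) 3
       (u z (inord 1)) (u z (inord 2)) (u z (inord 3)))`_i.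
  by move=> Dz i; rewrite -meval_j_polynomial_field; have [_] := H z Dz; apply.
have n0 : 1728 != 0 :> CC R by rewrite pnatr_eq0.
have Pu w : D w -> meval (u w) P = 0.
  by move=> Dw; rewrite -phiE; exact: P0 (on_curve w Dw).
exact: (curve_dense (@disc_open R r) y_neq0 y1_neq0 du n0 D0 Pu).
Qed.

(** * Constructibility *)
Section Constructible.
Variables (C : numClosedFieldType) (K : set C).
Hypothesis ratK : rationals C `<=` K.

Lemma defined_over_sub n (P : mpoly n C) :
  defined_over (rationals C) P -> defined_over K P.
Proof. by move=> h m; exact: ratK. Qed.

Lemma constructible_singular : constructible K
  [set pq : 'rV[C]_(4 + 4) | Sing (@j_polynomial_field C) (lsubmx pq)].
Proof.
pose P := j_component (2^-1 : C) 1728 1968 (1536 * 1728) 3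
  (lshift 4 (inord 1 : 'I_4)) (lshift 4 (inord 2 : 'I_4)) (lshift 4 (inord 3 : 'I_4)) 0.
have -> : [set pq : 'rV[C]_(4 + 4) | Sing (@j_polynomial_field C) (lsubmx pq)] =
    [set pq | peval P pq = 0].
  have E pq : peval (j_polynomial_field C ord0) (lsubmx pq) = peval P pq.
    by rewrite /peval !meval_j_component !mxE.
  by apply/seteqP; split=> pq; rewrite /= Sing_j_polynomial_field E.
by apply/constructible_zeros/defined_over_sub/j_component_rational.
Qed.

Lemma constructible_diagonal :
  constructible K [set pq : 'rV[C]_(4 + 4) | rsubmx pq = lsubmx pq].
Proof.
pose Z (i : 'I_4) := [set pq : 'rV[C]_(4 + 4) |
  peval (mpolyX C (mnm1 (rshift 4 i)) - mpolyX C (mnm1 (lshift 4 i))) pq = 0].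
have cZ i : constructible K (Z i).
  by apply/constructible_zeros/defined_over_sub/subX_rational.
have ZE i pq : Z i pq <-> rsubmx pq 0 i = lsubmx pq 0 i.
  by rewrite /Z /= /peval mevalB !mevalXU !mxE; split=> [/subr0_eq|->]; rewrite ?subrr.
have -> : [set pq : 'rV[C]_(4 + 4) | rsubmx pq = lsubmx pq] =
    Z (inord 0) `&` (Z (inord 1) `&` (Z (inord 2) `&` Z (inord 3))).
  apply/seteqP; split=> [pq /= E|pq /= [/ZE h0 [/ZE h1 [/ZE h2 /ZE h3]]]].
    by do !split; apply/ZE; rewrite E.
  have e k (lt : (k < 4)%N) : inord k = Ordinal lt by apply/val_inj; rewrite /= inordK.
  by apply/rowP => -[[|[|[|[|//]]]] lt]; rewrite -e.
by do 3!apply: constructibleI => //.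
Qed.

End Constructible.

Lemma singular_orbit_closure (C : numClosedFieldType) n (X : 'I_n -> mpoly n C) (p : 'rV[C]_n) :
  Sing X p -> zariski_closure (Defs.orbit X p) = [set p].
Proof.
move=> Sp; apply/seteqP; split=> [q qp|_ -> P]; last by apply; left.
apply/rowP => i.
have := qp (mpolyX C (mnm1 i) - mpolyC n (p 0 i)); rewrite /peval mevalB mevalXU mevalC.
move=> h; apply/subr0_eq/h => _ [[_ ->]|[/(_ Sp) []]].
by rewrite mevalB mevalXU mevalC subrr.
Qed.

Lemma orbit_relation_j (R : realType) :
  orbit_relation (@j_polynomial_field (CC R)) setT =
  ~` ([set pq | Sing (@j_polynomial_field (CC R)) (lsubmx pq)] `&` ~` [set pq | rsubmx pq = lsubmx pq]).
Proof.
apply/seteqP; split=> pq /=.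
  case=> _ _ h [Sp]; apply; rewrite (singular_orbit_closure Sp) in h.
  exact: h.
move=> h; split=> //; have [Sp|nSp] := pselect (Sing (@j_polynomial_field (CC R)) (lsubmx pq)).
  rewrite singular_orbit_closure //=; apply: contrapT => ne; exact: h.
by rewrite nonsingular_orbit_dense.
Qed.

Theorem corollary31 (R : realType) :
  exists X : 'I_4 -> {mpoly R[i][4]},
    [/\ forall i, FracField.tofrac (X i) = j_field R[i] i,
        forall i, defined_over (rationals R[i]) (X i)
      & has_constructible_orbits (algebraic_numbers R[i]) X [set: 'rV[R[i]]_4]].
Proof.
exists (@j_polynomial_field (CC R)); split.
- exact: tofrac_j_polynomial_field.
- by move=> i; exact: j_component_rational.
rewrite /has_constructible_orbits orbit_relation_j.
have ratK := @rationals_algebraic (CC R).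
apply/constructibleC/constructibleI; first exact: constructible_singular.
exact/constructibleC/constructible_diagonal.
Qed.
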